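(* Let $M\subset\mathbb{C}^{n+1}$ be defined by $\rho=0$, $d\rho\ne0$, where $\rho$ is a strictly plurisubharmonic defining function on an open set $U$ containing $M$, and let $\iota\colon M\to U$ be the inclusion. Put $\theta=\iota^*(i\bar\partial\rho)$ and $\omega=i\partial\bar\partial\rho$. Then $\iota\colon(M,\theta)\to(U,\omega)$ is a semi-isometric CR immersion. Moreover, for a local frame $\{Z_\alpha\}_{\alpha=1}^n$ of $T^{1,0}M$, with $Z_{\bar\alpha}=\overline{Z_\alpha}$, the second fundamental form satisfies $$I\!I(Z_{\bar\alpha},Z_\beta)=-h_{\beta\bar\alpha}\,\xi .$$ In particular, the squared mean curvature $|H|^2$ coincides with the transverse curvature of $\rho$: $$r(\rho)=|\xi|^2_\omega=|H|^2_\omega .$$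
   Context: Semi-isometric means $d\theta=\iota^*\omega$. $h_{\beta\bar\alpha}=-i\,d\theta(Z_\beta,Z_{\bar\alpha})$ is the Levi matrix. The transverse vector field $\xi=\xi^j\partial_j$ of $\rho$ is the $(1,0)$-field with $\partial\rho(\xi)=1$ and $\xi\rfloor\partial\bar\partial\rho=0\mod\bar\partial\rho$; the transverse curvature of $\rho$ is $r(\rho)=\rho_{j\bar k}\xi^j\overline{\xi^k}|_M$, where $\rho_{j\bar k}=\partial^2\rho/\partial z^j\partial\bar z^k$. The metric of $\omega=i\partial\bar\partial\rho$ is $\langle\partial_j,\partial_{\bar k}\rangle=\rho_{j\bar k}$, and $|V|^2_\omega=\langle V,\overline V\rangle$. The second fundamental form is $I\!I(X,Y)=\widetilde\nabla_XY-\nabla_XY$ for sections $X,Y$ of $\mathbb{C}TM$ ($Y$ extended smoothly to $U$ in the first term), where $\widetilde\nabla$ is the Chern connection of $\omega$ and $\nabla$ the Tanaka-Webster connection of $(M,\theta)$. The $(1,0)$-mean curvature vector is $H=\frac1n\sum_{\alpha=1}^nI\!I(Z_{\bar\alpha},Z_\alpha)$ for a frame $\{Z_\alpha\}$ of $T^{1,0}M$ orthonormal with respect to the Levi form $-i\,d\theta$. *)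

(* Defs.v *)
From HB Require Import structures.
From mathcomp Require Import all_boot all_order all_algebra.
From mathcomp Require Import all_classical all_reals all_analysis.
From mathcomp Require Import complex.
Set Implicit Arguments.
Unset Strict Implicit.
Unset Printing Implicit Defensive.
Import Order.TTheory GRing.Theory Num.Theory.
Import numFieldNormedType.Exports.
Local Open Scope classical_set_scope.
Local Open Scope ring_scope.

(* [cspace R N] is C^N as a real normed space: (x, y) stands for z = x + i y.
   [cvec R N] is the complexified tangent space of C^N at any point: (a, b)
   stands for \sum_j a_j d/dz^j + b_j d/d\bar z^j, so that the (1,0)-vectors are
   the (a, 0) and the (0,1)-vectors the (0, b). *)
Notation cspace R N := ('rV[R]_N * 'rV[R]_N)%type.
Notation cvec R N := ('rV[R[i]]_N * 'rV[R[i]]_N)%type.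

Definition conjv {R : realType} {N : nat} (X : cvec R N) : cvec R N :=
  (map_mx conjc X.2, map_mx conjc X.1).

Definition T10 {R : realType} {N : nat} : set (cvec R N) := [set X | X.2 = 0].
Definition T01 {R : realType} {N : nat} : set (cvec R N) := [set X | X.1 = 0].

Definition Dc {R : realType} {N : nat} (v : cspace R N) (f : cspace R N -> R[i])
    (p : cspace R N) : R[i] :=
  ('D_v (fun q => complex.Re (f q)) p +i* 'D_v (fun q => complex.Im (f q)) p)%C.

Definition dz {R : realType} {N : nat} (j : 'I_N) (f : cspace R N -> R[i])
    (p : cspace R N) : R[i] :=
  2^-1 * (Dc (delta_mx 0 j, 0) f p - 'i%C * Dc (0, delta_mx 0 j) f p).
Definition dzbar {R : realType} {N : nat} (j : 'I_N) (f : cspace R N -> R[i])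
    (p : cspace R N) : R[i] :=
  2^-1 * (Dc (delta_mx 0 j, 0) f p + 'i%C * Dc (0, delta_mx 0 j) f p).

Definition del {R : realType} {N : nat} (f : cspace R N -> R[i])
    (p : cspace R N) (X : cvec R N) : R[i] := \sum_j X.1 0 j * dz j f p.
Definition delbar {R : realType} {N : nat} (f : cspace R N -> R[i])
    (p : cspace R N) (X : cvec R N) : R[i] := \sum_j X.2 0 j * dzbar j f p.

(* X f at p; as a function of X this is the differential df at p. *)
Definition act {R : realType} {N : nat} (X : cvec R N) (f : cspace R N -> R[i])
    (p : cspace R N) : R[i] := del f p X + delbar f p X.

Fixpoint ndiff {R : realType} {N : nat} (k : nat) (V : set (cspace R N))
    (f : cspace R N -> R) : Prop :=
  if k is k'.+1 then
    (forall p, V p -> differentiable f p) /\ (forall v, ndiff k' V ('D_v f))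
  else True.

Definition smooth {R : realType} {N : nat} (V : set (cspace R N))
    (f : cspace R N -> R) : Prop := forall k, ndiff k V f.

Definition csmooth {R : realType} {N : nat} (V : set (cspace R N))
    (f : cspace R N -> R[i]) : Prop :=
  smooth V (fun p => complex.Re (f p)) /\ smooth V (fun p => complex.Im (f p)).

Definition smooth_field {R : realType} {N : nat} (V : set (cspace R N))
    (X : cspace R N -> cvec R N) : Prop :=
  forall j, csmooth V (fun p => (X p).1 0 j) /\ csmooth V (fun p => (X p).2 0 j).

Definition bracket {R : realType} {N : nat} (X Y : cspace R N -> cvec R N)
    (p : cspace R N) : cvec R N :=
  (\row_j (act (X p) (fun q => (Y q).1 0 j) p - act (Y p) (fun q => (X q).1 0 j) p),
   \row_j (act (X p) (fun q => (Y q).2 0 j) p - act (Y p) (fun q => (X q).2 0 j) p)).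

Definition form1 (R : realType) (N : nat) := cspace R N -> cvec R N -> R[i].
Definition form2 (R : realType) (N : nat) :=
  cspace R N -> cvec R N -> cvec R N -> R[i].

(* Cartan's formula, with d theta(X, Y) not halved.  For a 1-form on a
   submanifold it is used only on fields X, Y that are tangent to it. *)
Definition extd {R : realType} {N : nat} (theta : form1 R N)
    (X Y : cspace R N -> cvec R N) (p : cspace R N) : R[i] :=
  act (X p) (fun q => theta q (Y q)) p - act (Y p) (fun q => theta q (X q)) p
  - theta p (bracket X Y p).

Definition coordc {R : realType} {N : nat} (j : 'I_N) (p : cspace R N) : R[i] :=
  (p.1 0 j +i* p.2 0 j)%C.

Definition smooth_map {R : realType} {N m : nat} (V : set (cspace R N))
    (F : cspace R N -> cspace R m) : Prop :=
  forall j, csmooth V (fun p => coordc j (F p)).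

Definition pushforward {R : realType} {N m : nat} (F : cspace R N -> cspace R m)
    (p : cspace R N) (X : cvec R N) : cvec R m :=
  (\row_j act X (fun q => coordc j (F q)) p,
   \row_j act X (fun q => conjc (coordc j (F q))) p).

Definition pullback1 {R : realType} {N m : nat} (F : cspace R N -> cspace R m)
    (eta : form1 R m) : form1 R N :=
  fun p X => eta (F p) (pushforward F p X).
Definition pullback2 {R : realType} {N m : nat} (F : cspace R N -> cspace R m)
    (eta : form2 R m) : form2 R N :=
  fun p X Y => eta (F p) (pushforward F p X) (pushforward F p Y).

Definition cplx {R : realType} {N : nat} (rho : cspace R N -> R)
    (p : cspace R N) : R[i] := (rho p)%:C%C.

(* \rho_{j\bar k} *)
Definition hess {R : realType} {N : nat} (rho : cspace R N -> R) (p : cspace R N)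
    (j k : 'I_N) : R[i] := dz j (dzbar k (cplx rho)) p.

Definition strictly_psh {R : realType} {N : nat} (U : set (cspace R N))
    (rho : cspace R N -> R) : Prop :=
  forall p, U p -> forall v : 'rV[R[i]]_N, v != 0 ->
    0 < \sum_j \sum_k hess rho p j k * v 0 j * conjc (v 0 k).

Definition hypersurface {R : realType} {N : nat} (U : set (cspace R N))
    (rho : cspace R N -> R) : set (cspace R N) := [set p | U p /\ rho p = 0].

(* The fibre of CTM at p, for M = {rho = 0}. *)
Definition CTM {R : realType} {N : nat} (rho : cspace R N -> R)
    (p : cspace R N) : set (cvec R N) := [set X | act X (cplx rho) p = 0].

Definition deldelbar {R : realType} {N : nat} (rho : cspace R N -> R) : form2 R N :=
  fun p X Y => \sum_j \sum_k
    hess rho p j k * (X.1 0 j * Y.2 0 k - Y.1 0 j * X.2 0 k).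

Definition omega {R : realType} {N : nat} (rho : cspace R N -> R) : form2 R N :=
  fun p X Y => 'i%C * deldelbar rho p X Y.

(* The metric of omega, extended to a symmetric complex-bilinear form: it pairs
   d/dz^j with d/d\bar z^k to \rho_{j\bar k} and vanishes on pairs of equal type. *)
Definition metric {R : realType} {N : nat} (rho : cspace R N -> R) : form2 R N :=
  fun p X Y => \sum_j \sum_k
    hess rho p j k * (X.1 0 j * Y.2 0 k + Y.1 0 j * X.2 0 k).

Definition sqnorm {R : realType} {N : nat} (g : form2 R N) (p : cspace R N)
    (X : cvec R N) : R[i] := g p X (conjv X).

(* The inclusion of M into U is idfun. *)
Definition theta {R : realType} {N : nat} (rho : cspace R N -> R) : form1 R N :=
  pullback1 idfun (fun p X => 'i%C * delbar (cplx rho) p X).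

Definition vec10 {R : realType} {N : nat} (a : 'rV[R[i]]_N) : cvec R N := (a, 0).

Definition transverse_field {R : realType} {N : nat} (M : set (cspace R N))
    (rho : cspace R N -> R) (xi : cspace R N -> 'rV[R[i]]_N) : Prop :=
  forall p, M p ->
    del (cplx rho) p (vec10 (xi p)) = 1 /\
    exists c : R[i], forall Y : cvec R N,
      deldelbar rho p (vec10 (xi p)) Y = c * delbar (cplx rho) p Y.

Definition transverse_curvature {R : realType} {N : nat} (rho : cspace R N -> R)
    (xi : cspace R N -> 'rV[R[i]]_N) (p : cspace R N) : R[i] :=
  \sum_j \sum_k hess rho p j k * xi p 0 j * conjc (xi p 0 k).

(* Y represents near p a smooth section over M of the bundle with fibres E q.
   M is embedded, so a smooth section over M is locally the restriction of a
   smooth field on an open set; only the values of Y on M are constrained. *)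
Definition section_near {R : realType} {N : nat} (M : set (cspace R N))
    (E : cspace R N -> set (cvec R N)) (p : cspace R N)
    (Y : cspace R N -> cvec R N) : Prop :=
  exists2 V : set (cspace R N), open_nbhs p V &
    smooth_field V Y /\ forall q, V q -> M q -> E q (Y q).

Definition T10M {R : realType} {N : nat} (TM : cspace R N -> set (cvec R N))
    (p : cspace R N) : set (cvec R N) := TM p `&` T10.

Definition conjf {R : realType} {N : nat} (Y : cspace R N -> cvec R N) :
  cspace R N -> cvec R N := fun p => conjv (Y p).

(* A connection on the bundle TM over M (with M open and TM = setT allowed):
   nabla p v Y is the derivative at p of the section Y in the direction v. *)
Record is_connection {R : realType} {N : nat} (M : set (cspace R N))
    (TM : cspace R N -> set (cvec R N))
    (nabla : cspace R N -> cvec R N -> (cspace R N -> cvec R N) -> cvec R N)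
    : Prop := IsConnection {
  conn_smooth : forall p X Y, M p ->
    section_near M TM p X -> section_near M TM p Y ->
    exists2 W, section_near M TM p W &
      \forall q \near p, M q -> nabla q (X q) Y = W q;
  conn_local : forall p v Y Y', M p -> TM p v ->
    section_near M TM p Y -> section_near M TM p Y' ->
    (\forall q \near p, M q -> Y q = Y' q) -> nabla p v Y = nabla p v Y';
  conn_linear : forall p (c : R[i]) v w Y, M p -> TM p v -> TM p w ->
    section_near M TM p Y ->
    nabla p (c *: v + w) Y = c *: nabla p v Y + nabla p w Y;
  conn_add : forall p v Y Y', M p -> TM p v ->
    section_near M TM p Y -> section_near M TM p Y' ->
    nabla p v (fun q => Y q + Y' q) = nabla p v Y + nabla p v Y';
  conn_leibniz : forall p v (f : cspace R N -> R[i]) Y, M p -> TM p v ->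
    (exists2 V, open_nbhs p V & csmooth V f) -> section_near M TM p Y ->
    nabla p v (fun q => f q *: Y q) = act v f p *: Y p + f p *: nabla p v Y;
  (* the complex-linear extension of a connection on the real tangent bundle *)
  conn_real : forall p v Y, M p -> TM p v -> section_near M TM p Y ->
    nabla p (conjv v) (conjf Y) = conjv (nabla p v Y)
}.

(* The Chern connection of the Hermitian metric g on U, extended to the whole
   complexified tangent bundle by conjugation: it preserves T^{1,0}, is compatible
   with g, and its (0,1)-part on T^{1,0} is the Cauchy-Riemann operator. *)
Record chern_connection {R : realType} {N : nat} (U : set (cspace R N))
    (g : form2 R N)
    (nabla : cspace R N -> cvec R N -> (cspace R N -> cvec R N) -> cvec R N)
    : Prop := ChernConnection {
  chern_conn : is_connection U (fun _ => setT) nabla;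
  chern_T10 : forall p v Y, U p -> section_near U (fun _ => T10) p Y ->
    T10 (nabla p v Y);
  chern_metric : forall p v Y Z, U p ->
    section_near U (fun _ => setT) p Y -> section_near U (fun _ => setT) p Z ->
    act v (fun q => g q (Y q) (Z q)) p
    = g p (nabla p v Y) (Z p) + g p (Y p) (nabla p v Z);
  chern_dbar : forall p v Y, U p -> T01 v ->
    section_near U (fun _ => T10) p Y ->
    nabla p v Y = vec10 (\row_j act v (fun q => (Y q).1 0 j) p)
}.

Definition reeb_field {R : realType} {N : nat} (M : set (cspace R N))
    (TM : cspace R N -> set (cvec R N)) (theta : form1 R N)
    (T : cspace R N -> cvec R N) : Prop :=
  forall p, M p ->
    [/\ section_near M TM p T, conjv (T p) = T p, theta p (T p) = 1 &
        forall Y, section_near M TM p Y -> extd theta T Y p = 0].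

Definition torsion {R : realType} {N : nat}
    (nabla : cspace R N -> cvec R N -> (cspace R N -> cvec R N) -> cvec R N)
    (X Y : cspace R N -> cvec R N) (p : cspace R N) : cvec R N :=
  nabla p (X p) Y - nabla p (Y p) X - bracket X Y p.

(* In [tw_levi] (the Levi form is parallel) the sections A and B carry the vectors
   nabla_v Z and nabla_v \bar W at p, where alone d theta depends on them.
   [tw_torsion11] is T(Z_alpha, Z_\bar\beta) = i h_{alpha\bar\beta} T, and
   [tw_torsionT] is T(T, J X) = - J T(T, X). *)
Record tanaka_webster {R : realType} {N : nat} (M : set (cspace R N))
    (TM : cspace R N -> set (cvec R N)) (theta : form1 R N)
    (T : cspace R N -> cvec R N)
    (nabla : cspace R N -> cvec R N -> (cspace R N -> cvec R N) -> cvec R N)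
    : Prop := TanakaWebster {
  tw_conn : is_connection M TM nabla;
  tw_T10 : forall p v Z, M p -> TM p v -> section_near M (T10M TM) p Z ->
    T10M TM p (nabla p v Z);
  tw_reeb : forall p v, M p -> TM p v -> nabla p v T = 0;
  tw_levi : forall p v Z W A B, M p -> TM p v ->
    section_near M (T10M TM) p Z -> section_near M (T10M TM) p W ->
    section_near M TM p A -> section_near M TM p B ->
    A p = nabla p v Z -> B p = nabla p v (conjf W) ->
    act v (extd theta Z (conjf W)) p
    = extd theta A (conjf W) p + extd theta Z B p;
  tw_torsion20 : forall p Z W, M p ->
    section_near M (T10M TM) p Z -> section_near M (T10M TM) p W ->
    torsion nabla Z W p = 0;
  tw_torsion11 : forall p Z W, M p ->
    section_near M (T10M TM) p Z -> section_near M (T10M TM) p W ->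
    torsion nabla Z (conjf W) p = extd theta Z (conjf W) p *: T p;
  tw_torsionT : forall p Z, M p -> section_near M (T10M TM) p Z ->
    T01 (torsion nabla T Z p)
}.

Definition levi {R : realType} {N n : nat} (theta : form1 R N)
    (Z : 'I_n -> cspace R N -> cvec R N) (p : cspace R N) (b a : 'I_n) : R[i] :=
  - 'i%C * extd theta (Z b) (conjf (Z a)) p.

(* A frame of T^{1,0}M over M `&` V; M has CR dimension n in C^{n+1}. *)
Definition local_frame {R : realType} {n : nat} (M : set (cspace R n.+1))
    (TM : cspace R n.+1 -> set (cvec R n.+1)) (V : set (cspace R n.+1))
    (Z : 'I_n -> cspace R n.+1 -> cvec R n.+1) : Prop :=
  [/\ open V, forall a, smooth_field V (Z a) &
      forall q, V q -> M q ->
        (forall a, T10M TM q (Z a q)) /\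
        row_free (\matrix_(a < n, j < n.+1) (Z a q).1 0 j)].

Definition orthonormal_frame {R : realType} {n : nat} (M : set (cspace R n.+1))
    (TM : cspace R n.+1 -> set (cvec R n.+1)) (theta : form1 R n.+1)
    (V : set (cspace R n.+1)) (Z : 'I_n -> cspace R n.+1 -> cvec R n.+1) : Prop :=
  local_frame M TM V Z /\
  forall q, V q -> M q -> forall b a, levi theta Z q b a = (b == a)%:R.

(* nt is the ambient connection, nb that of M. *)
Definition second_fundamental_form {R : realType} {N : nat}
    (nt nb : cspace R N -> cvec R N -> (cspace R N -> cvec R N) -> cvec R N)
    (X Y : cspace R N -> cvec R N) (p : cspace R N) : cvec R N :=
  nt p (X p) Y - nb p (X p) Y.

Definition mean_curvature {R : realType} {N n : nat}
    (nt nb : cspace R N -> cvec R N -> (cspace R N -> cvec R N) -> cvec R N)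
    (Z : 'I_n -> cspace R N -> cvec R N) (p : cspace R N) : cvec R N :=
  (n%:R^-1 : R[i]) *:
    \sum_(a < n) second_fundamental_form nt nb (conjf (Z a)) (Z a) p.

Definition pseudohermitian {R : realType} {N : nat} (M : set (cspace R N))
    (TM : cspace R N -> set (cvec R N)) (theta : form1 R N) : Prop :=
  forall p, M p ->
    [/\ forall X, TM p X -> theta p (conjv X) = conjc (theta p X),
        forall X, T10M TM p X -> theta p X = 0 /\ theta p (conjv X) = 0,
        exists2 X, TM p X & theta p X != 0 &
        forall Z, section_near M (T10M TM) p Z -> Z p != 0 ->
          0 < - 'i%C * extd theta Z (conjf Z) p].

Definition CR_immersion {R : realType} {N m : nat} (M : set (cspace R N))
    (TM : cspace R N -> set (cvec R N)) (U : set (cspace R m))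
    (F : cspace R N -> cspace R m) : Prop :=
  forall p, M p ->
    [/\ U (F p),
        exists2 V, open_nbhs p V & smooth_map V F,
        forall X, TM p X -> pushforward F p X = 0 -> X = 0 &
        forall X, T10M TM p X -> T10 (pushforward F p X)].

Definition semi_isometric {R : realType} {N m : nat} (M : set (cspace R N))
    (TM : cspace R N -> set (cvec R N)) (theta : form1 R N)
    (F : cspace R N -> cspace R m) (w : form2 R m) : Prop :=
  forall p X Y, M p -> section_near M TM p X -> section_near M TM p Y ->
    extd theta X Y p = pullback2 F w p (X p) (Y p).

(* Main.v *)
Require Import Defs.
From HB Require Import structures.
From mathcomp Require Import all_boot all_order all_algebra.
From mathcomp Require Import all_classical all_reals all_analysis.
From mathcomp Require Import complex ring lra.
Import Order.TTheory GRing.Theory Num.Theory.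
Import numFieldNormedType.Exports.

(** The form [theta = i delbar rho] satisfies [d theta = i del delbar rho =
    omega] already in the ambient space ([extd_theta]), because the second
    derivatives of [rho] are symmetric ([derive_comm]).  Restricted to [M] this
    says that the inclusion is semi-isometric, and strict plurisubharmonicity
    of [rho] makes the Levi form positive ([theta_pseudohermitian]).

    Let [Z] and [W] be sections of T^{1,0}M and write [conj W] for the conjugate
    of [W].  The Chern derivative of [Z] along [conj W] is the componentwise
    derivative [(conj W) Z], by the Cauchy-Riemann condition
    ([chern_derivative]).  The Tanaka-Webster derivative is determined by the
    torsion identity
      [nabla_Z (conj W) - nabla_(conj W) Z - [Z, conj W] = d theta (Z, conj W) T];
    the first term has type (0,1), so that the (1,0)-part of the identity is
      [nabla_(conj W) Z = (conj W) Z - d theta (Z, conj W) T^{1,0}]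
    ([tanaka_webster_derivative]).  The difference of the two connections is
    therefore [d theta (Z, conj W) T^{1,0}], and the Reeb field has (1,0)-part
    [i xi] ([reeb_transverse]).  With [d theta (Z_b, conj Z_a) = i h] this is
    [- h xi].  In an orthonormal frame the average over [a = b] is [- xi], so
    the mean curvature vector has the same length as [xi].

    A section of T^{1,0}M is prescribed on [M] only, while the connections and
    brackets differentiate an extension of it.  The extension is harmless
    because a function that vanishes on [M] has zero derivative along every
    complex tangent vector of [M] ([derive_level_set], [act_level_set]). *)

Set Implicit Arguments.
Unset Strict Implicit.
Unset Printing Implicit Defensive.

Local Open Scope classical_set_scope.
Local Open Scope ring_scope.

(** * Second derivatives and level sets in real normed spaces *)

Lemma is_derive_line (R : realType) (W : normedModType R) (f : W -> R)
    (x v : W) (s : R) :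
  differentiable f (s *: v + x) ->
  is_derive s 1 (fun t => f (t *: v + x)) ('D_v f (s *: v + x)).
Proof.
move=> df; have dv := @diff_derivable _ _ _ _ _ v df.
have E : (fun h : R => h^-1 *: (((fun t : R => f (t *: v + x)) \o shift s) (h *: 1)
            - f (s *: v + x)))
       = (fun h : R => h^-1 *: ((f \o shift (s *: v + x)) (h *: v) - f (s *: v + x))).
  by apply/funext => h /=; rewrite [h *: 1]mulr1 scalerDl addrA.
by split; rewrite /derivable /derive E.
Qed.

Lemma differentiable_estimate (R : realType) (W : normedModType R)
    (f : W -> R) (x : W) (e : R) : differentiable f x -> 0 < e ->
  \forall h \near 0, `|f (h + x) - f x - 'D_h f x| <= e * `|h|.
Proof.
move=> df e0.
have /eqaddoP/(_ e e0) := diff_locally df.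
apply: filterS => h /=.
by rewrite deriveE// opprD addrA.
Qed.

Lemma derive_linear (R : realType) (W : normedModType R) (f : W -> R) (p v w : W)
    (a b : R) : differentiable f p ->
  'D_(a *: v + b *: w) f p = a * 'D_v f p + b * 'D_w f p.
Proof. by move=> df; rewrite !deriveE// linearD !linearZ. Qed.

Lemma near_small (R : realType) (W : normedModType R) (p : W) (P : set W) :
  (\forall q \near p, P q) ->
  exists2 d : R, 0 < d & forall h, `|h| < d -> P (h + p).
Proof.
move=> /nbhs_normP[d /= d0 Pd]; exists d => // h hd; apply: Pd.
by rewrite /= opprD addrCA subrr addr0 normrN.
Qed.

Lemma near0_small (R : realType) (W : normedModType R) (P : set W) :
  (\forall h \near 0, P h) -> exists2 d : R, 0 < d & forall h, `|h| < d -> P h.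
Proof.
by move=> /near_small[d d0 Pd]; exists d => // h /Pd; rewrite addr0.
Qed.

Definition second_difference (R : realType) (W : normedModType R) (f : W -> R)
    (p v w : W) : R :=
  f (v + w + p) - f (v + p) - f (w + p) + f p.

Lemma second_differenceC (R : realType) (W : normedModType R) (f : W -> R)
    (p v w : W) : second_difference f p v w = second_difference f p w v.
Proof. by rewrite /second_difference (addrC v w); ring. Qed.

(** The mean value theorem, applied to [s |-> f (s v + t w + p) - f (s v + p)],
    turns the second difference into [t] times a difference of values of
    ['D_v f] at two points within [O(t)] of [p]; the first-order expansion of
    ['D_v f] at [p] then gives its value up to [o(t^2)]. *)
Lemma second_difference_estimate (R : realType) (W : normedModType R)
    (f : W -> R) (p v w : W) (e : R) :
  (\forall q \near p, differentiable f q) -> differentiable ('D_v f) p ->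
  0 < e ->
  exists2 d : R, 0 < d & forall t, 0 < t -> t < d ->
    `|second_difference f p (t *: v) (t *: w) - t ^+ 2 * 'D_w ('D_v f) p|
      <= e * t ^+ 2.
Proof.
move=> df dDf e0.
(* For 0 <= s, u <= t, the vector s v + u w has norm at most t K. *)
set K : R := `|v| + `|w| + 1.
have K0 : 0 < K by rewrite ltr_wpDl// addr_ge0.
have e1 : 0 < e / (2 * K) by rewrite divr_gt0// mulr_gt0.
have /near0_small[d1 d1_gt0 H1] := differentiable_estimate dDf e1.
have [d2 d2_gt0 H2] := near_small df.
exists (Num.min d1 d2 / K); first by rewrite divr_gt0// lt_min d1_gt0.
move=> t t0; rewrite ltr_pdivlMr// lt_min => /andP[td1 td2].
have bnd (s u : R) : 0 <= s <= t -> 0 <= u <= t -> `|s *: v + u *: w| <= t * K.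
  move=> /andP[s0 st] /andP[u0 ut].
  rewrite (le_trans (ler_normD _ _))// !normrZ !ger0_norm// /K mulrDr mulrDr mulr1.
  by apply: (ler_wpDr (ltW t0)); rewrite lerD// ler_wpM2r.
have tt : 0 <= t <= t by rewrite lexx ltW.
have ot : 0 <= (0 : R) <= t by rewrite lexx ltW.
pose g s := f (s *: v + (t *: w + p)) - f (s *: v + p).
pose dg s := 'D_v f (s *: v + (t *: w + p)) - 'D_v f (s *: v + p).
have gd s : 0 <= s <= t -> is_derive s 1 g (dg s).
  move=> st.
  have D1 : differentiable f (s *: v + (t *: w + p)).
    by rewrite addrA; apply: H2; apply: le_lt_trans td2; exact: bnd.
  have D2 : differentiable f (s *: v + p).
    by apply: H2; apply: le_lt_trans td2; rewrite -[s *: v]addr0 -(scale0r w); exact: bnd.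
  have := is_derive_line D1; have := is_derive_line D2 => I2 I1.
  exact: (is_deriveB I1 I2).
have [c ct gE] : exists2 c, c \in `]0, t[%R & g t - g 0 = dg c * (t - 0).
  apply: (MVT (f := g) (df := dg)) => //.
    by move=> s; rewrite in_itv/= => /andP[s0 st]; apply: gd; rewrite !ltW.
  apply: derivable_within_continuous => s; rewrite in_itv/= => st.
  by have [] := gd _ st.
have {}ct : 0 <= c <= t by move: ct; rewrite in_itv/= => /andP[? ?]; rewrite !ltW.
have -> : second_difference f p (t *: v) (t *: w) = t * dg c.
  move: gE; rewrite subr0 (mulrC (dg c)) => <-.
  by rewrite /g /second_difference scale0r !add0r !addrA; ring.
have A1 := H1 _ (le_lt_trans (bnd _ _ ct tt) td1).
have A2 := H1 _ (le_lt_trans (bnd _ _ ct ot) td1).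
have B1 := bnd _ _ ct tt; have B2 := bnd _ _ ct ot.
rewrite derive_linear// in A1; rewrite derive_linear// in A2.
rewrite scale0r addr0 mul0r addr0 in A2 B2.
have -> : t * dg c - t ^+ 2 * 'D_w ('D_v f) p
  = t * (('D_v f (c *: v + t *: w + p) - 'D_v f p
           - (c * 'D_v ('D_v f) p + t * 'D_w ('D_v f) p))
         - ('D_v f (c *: v + p) - 'D_v f p - c * 'D_v ('D_v f) p)).
  rewrite /dg addrA; move: ('D_v f _) ('D_v f _) ('D_v f p) ('D_v _ p) ('D_w _ p).
  by move=> {}a1 a2 a3 a4 a5; ring.
rewrite normrM (gtr0_norm t0) expr2 mulrCA ler_pM2l//.
apply: (le_trans (ler_normB _ _)).
apply: (le_trans (lerD A1 A2)).
rewrite -mulrDr mulrAC ler_pdivrMr ?mulr_gt0//.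
rewrite -mulrA ler_pM2l//; lra.
Qed.

(** Symmetry of second derivatives: the second difference is symmetric in its two
    increments, and both mixed derivatives are its limit after division by
    [t^2]. *)
Lemma derive_comm (R : realType) (W : normedModType R) (f : W -> R) (p v w : W) :
  (\forall q \near p, differentiable f q) ->
  differentiable ('D_v f) p -> differentiable ('D_w f) p ->
  'D_w ('D_v f) p = 'D_v ('D_w f) p.
Proof.
move=> df dv dw; apply/eqP; rewrite -subr_eq0 -normr_le0.
apply/ler_addgt0Pl => e e0; rewrite addr0.
have e2 : 0 < e / 2 by rewrite divr_gt0.
have [d1 d10 H1] := second_difference_estimate w df dv e2.
have [d2 d20 H2] := second_difference_estimate v df dw e2.
pose t := Num.min d1 d2 / 2.
have t0 : 0 < t by rewrite divr_gt0// lt_min d10.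
have tmin : t < Num.min d1 d2 by rewrite /t ltr_pdivrMr// ltr_pMr ?ltr1n// lt_min d10.
move: tmin; rewrite lt_min => /andP[td1 td2].
have {}H1 := H1 _ t0 td1; have {}H2 := H2 _ t0 td2.
rewrite second_differenceC in H2.
have t20 : 0 < t ^+ 2 by rewrite exprn_gt0.
rewrite -(ler_pM2r t20) -{1}(gtr0_norm t20) -normrM.
move: H1 H2; move: (second_difference _ _ _ _) ('D_w _ p) ('D_v _ p) (t ^+ 2).
move=> D a b s; rewrite !ler_norml => /andP[a1 a2] /andP[b1 b2].
by apply/andP; split; lra.
Qed.

(** A function that vanishes on a regular level set has zero derivative in the
    tangential directions.  Instead of parametrizing the level set, move from
    [p] by [t v] and correct by [c w], with [w] transverse: the intermediate
    value theorem finds a point of the level set with [|c| <= e t], and the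
    first-order expansion of [f] at that point bounds ['D_v f p] by a multiple
    of [e]. *)
Lemma derive_level_set (R : realType) (W : normedModType R) (rho f : W -> R)
    (p v w : W) :
  (\forall q \near p, differentiable rho q) -> differentiable f p ->
  rho p = 0 -> 'D_v rho p = 0 -> 'D_w rho p <> 0 ->
  (\forall q \near p, rho q = 0 -> f q = 0) ->
  'D_v f p = 0.
Proof.
move=> drho df rhop0 dv0 /eqP dw0 f0.
wlog dw1 : w dw0 / 'D_w rho p = 1.
  have drp := nbhs_singleton drho.
  have := derive_linear w w ('D_w rho p)^-1 0 drp.
  rewrite mul0r scale0r !addr0 mulVf// => E /(_ (('D_w rho p)^-1 *: w)); apply => //.
  by rewrite E oner_eq0.
have drp := nbhs_singleton drho.
have fp0 : f p = 0 by exact: (nbhs_singleton f0).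
set K : R := `|v| + `|w| + 1.
have K0 : 0 < K by rewrite ltr_wpDl// addr_ge0.
suff bound (e : R) : 0 < e -> e <= 1 -> `|'D_v f p| <= e * (K + `|'D_w f p|).
  apply/eqP; rewrite -normr_le0; apply/ler_addgt0Pl => d d0; rewrite addr0.
  have C0 : 0 < K + `|'D_w f p| by rewrite ltr_wpDr.
  apply: (le_trans (bound (Num.min 1 (d / (K + `|'D_w f p|))) _ _)).
  - by rewrite lt_min ltr01 divr_gt0.
  - by rewrite ge_min lexx.
  - by rewrite -ler_pdivlMr// ge_min lexx orbT.
move=> e0 e1.
have eK : 0 < e / (2 * K) by rewrite divr_gt0// mulr_gt0.
have /near0_small[d1 d10 H1] := differentiable_estimate drp eK.
have /near0_small[d2 d20 H2] := differentiable_estimate df e0.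
have [d3 d30 H3] := near_small (filterI drho f0).
pose d := Num.min d1 (Num.min d2 d3).
have d0 : 0 < d by rewrite !lt_min d10 d20.
have [t t0 tKd] : exists2 t : R, 0 < t & t * K < d.
  exists (d / K / 2); first by rewrite !divr_gt0.
  have -> : d / K / 2 * K = d / 2 by field; rewrite gt_eqF.
  by rewrite ltr_pdivrMr// ltr_pMr ?ltr1n.
have et0 : 0 < e * t by rewrite mulr_gt0.
(* Since e <= 1, all the points p + s w + t v with |s| <= e t are within t K
   of p. *)
have bnd s : `|s| <= e * t -> `|s *: w + t *: v| <= t * K.
  move=> st; apply: (le_trans (ler_normD _ _)); rewrite !normrZ (gtr0_norm t0).
  rewrite /K !mulrDr mulr1 addrC; apply: (ler_wpDr (ltW t0)); rewrite lerD// ler_wpM2r//.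
  by rewrite (le_trans st)// ler_piMl// ltW.
have bd s : `|s| <= e * t -> `|s *: w + t *: v| < d by move=> /bnd /le_lt_trans ->.
pose g s := rho (s *: w + (t *: v + p)).
(* As 'D_v rho p = 0 and 'D_w rho p = 1, rho is close to s at p + s w + t v, so
   it changes sign between s = - e t and s = e t. *)
have gest s : `|s| <= e * t -> `|g s - s| <= e * t / 2.
  move=> st; have := bd _ st; rewrite lt_min => /andP[h1 _].
  have := H1 _ h1; rewrite rhop0 subr0 derive_linear// dw1 dv0 mulr1 mulr0 addr0.
  rewrite -addrA => /le_trans; apply.
  rewrite mulrAC ler_pdivrMr ?mulr_gt0// (_ : _ * (2 * K) = e * (t * K)); last by field.
  by rewrite ler_pM2l// bnd.
have [c cin gc0] : exists2 c, c \in `[- (e * t), e * t]%R & g c = 0.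
  apply: IVT; first by rewrite ge0_cp// ltW.
    apply: derivable_within_continuous => s; rewrite in_itv/= -ler_norml => st.
    have [|//] := @is_derive_line R W rho (t *: v + p) w s.
    have := bd _ st; rewrite !lt_min => /and3P[_ _ /H3[]].
    by rewrite -addrA.
  have a1 : `|- (e * t)| <= e * t by rewrite normrN gtr0_norm.
  have a2 : `|e * t| <= e * t by rewrite gtr0_norm.
  move: (gest _ a1) (gest _ a2); rewrite !ler_norml => /andP[_ g1] /andP[g2 _].
  rewrite ge_min le_max; apply/andP; split; apply/orP; [left|right]; lra.
move: cin; rewrite in_itv/= -ler_norml => ct.
have := bd _ ct; rewrite !lt_min => /and3P[_ h2 h3].
have fz : f (c *: w + t *: v + p) = 0 by have [_] := H3 _ h3; rewrite -addrA; apply.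
have := H2 _ h2; rewrite fz fp0 subr0 sub0r derive_linear// normrN => A.
have A1 : `|t * 'D_v f p| <= e * (t * K) + e * t * `|'D_w f p|.
  have -> : t * 'D_v f p = (c * 'D_w f p + t * 'D_v f p) - c * 'D_w f p by ring.
  apply: (le_trans (ler_normB _ _)); apply: lerD.
    by apply: (le_trans A); rewrite ler_pM2l// bnd.
  by rewrite normrM ler_wpM2r.
rewrite normrM (gtr0_norm t0) in A1.
rewrite -(ler_pM2l t0) (le_trans A1)// le_eqVlt; apply/orP; left; apply/eqP; ring.
Qed.

(** * Smooth functions on an open set *)

Lemma differentiable_near_eq (R : realType) (W W' : normedModType R)
    (f g : W -> W') (x : W) :
  (\forall q \near x, f q = g q) -> differentiable f x -> differentiable g x.
Proof.
move=> fg /diff_locallyP[cdf ef].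
have eg : g \o shift x = cst (g x) + 'd f x +o_ (0 : W) id.
  apply/eqaddoP => e e0; move/eqaddoP : ef => /(_ e e0).
  have [d d0 Hd] := near_small fg.
  have near_fg : \forall h \near (0 : W), f (h + x) = g (h + x).
    apply/nbhs_normP; exists d => // h /=.
    by rewrite sub0r normrN => /Hd.
  apply: filterS2 near_fg => h Eh.
  rewrite -[((g \o shift x) - _) h]/(g (h + x) - (g x + 'd f x h)).
  by rewrite -Eh -(nbhs_singleton fg).
by apply/diff_locallyP; rewrite (diff_unique cdf eg).
Qed.

Lemma differentiable_fst (R : realType) (W W' : normedModType R) (p : W * W') :
  differentiable (fst : W * W' -> W) p.
Proof.
have lin : linear (fst : (W * W')%type -> W) by [].
pose L : {linear (W * W')%type -> W} := HB.pack (fst : W * W' -> W)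
  (GRing.isLinear.Build R _ _ _ _ lin).
by apply: (@linear_differentiable _ _ _ L) => q; exact: cvg_fst.
Qed.

Lemma differentiable_snd (R : realType) (W W' : normedModType R) (p : W * W') :
  differentiable (snd : W * W' -> W') p.
Proof.
have lin : linear (snd : (W * W')%type -> W') by [].
pose L : {linear (W * W')%type -> W'} := HB.pack (snd : W * W' -> W')
  (GRing.isLinear.Build R _ _ _ _ lin).
by apply: (@linear_differentiable _ _ _ L) => q; exact: cvg_snd.
Qed.

(** The difference quotient of a linear function is constant. *)
Lemma derive_additive (R : realType) (W : normedModType R) (f : W -> R)
    (v p : W) :
  (forall x y, f (x + y) = f x + f y) -> (forall a x, f (a *: x) = a * f x) ->
  'D_v f p = f v.
Proof.
move=> fD fZ; apply: cvg_lim => //.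
apply: (@cvg_trans _ ((fun _ : R => f v) @ 0^')); last exact: cvg_cst.
apply: near_eq_cvg; near=> h.
have h0 : h != 0 by near: h; exact: nbhs_dnbhs_neq.
by rewrite /= fD fZ addrK /GRing.scale/= mulKf.
Unshelve. all: by end_near. Qed.

Section RealSmooth.
Context {R : realType} {N : nat}.
Implicit Types (V : set (cspace R N)) (f g : cspace R N -> R) (p v : cspace R N).

Lemma open_near_eq V (T : Type) (F G : cspace R N -> T) p : open V -> V p ->
  (forall q, V q -> F q = G q) -> \forall q \near p, F q = G q.
Proof. by move=> Vo Vp FG; near=> q; apply: FG; near: q; exact: open_nbhs_nbhs.
Unshelve. all: by end_near. Qed.

(** The rules for derivatives hold only on the open set [V], whereas ['D_v f] is a
    function on the whole space; closure of [ndiff] under sums and products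
    therefore has to go through equalities that hold on [V] only. *)
Lemma eq_ndiff k V f g : open V -> (forall q, V q -> f q = g q) ->
  ndiff k V f -> ndiff k V g.
Proof.
move=> Vo; elim: k f g => [//|k IH] f g fg /= [df ddf]; split.
  move=> p Vp; apply: differentiable_near_eq (df p Vp).
  exact: open_near_eq Vo Vp fg.
move=> v; apply: IH (ddf v) => q Vq; apply: near_eq_derive.
exact: open_near_eq Vo Vq fg.
Qed.

Lemma ndiff_pred k V f : ndiff k.+1 V f -> ndiff k V f.
Proof.
elim: k f => [//|k IH] f [df ddf]; split => // v; exact: IH (ddf v).
Qed.

Lemma sub_ndiff k V V' f : V' `<=` V -> ndiff k V f -> ndiff k V' f.
Proof.
move=> sV; elim: k f => [//|k IH] f /= [df ddf]; split.
  by move=> p /sV; exact: df.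
by move=> v; exact: IH.
Qed.

Lemma ndiff_cst k V (c : R) : ndiff k V (fun=> c).
Proof.
elim: k c => [//|k IH] c /=; split; first by move=> p _; exact: differentiable_cst.
move=> v; rewrite (_ : 'D_v _ = fun=> 0); first exact: IH.
by apply/funext => p; exact: derive_cst.
Qed.

Lemma ndiffD k V f g : open V -> ndiff k V f -> ndiff k V g ->
  ndiff k V (fun q => f q + g q).
Proof.
move=> Vo; elim: k f g => [//|k IH] f g /= [df ddf] [dg ddg]; split.
  by move=> p Vp; apply: differentiableD; [exact: df|exact: dg].
move=> v; apply: (eq_ndiff Vo _ (IH _ _ (ddf v) (ddg v))) => q Vq.
by apply/esym/deriveD; apply: diff_derivable; [exact: df|exact: dg].
Qed.

Lemma ndiffM k V f g : open V -> ndiff k V f -> ndiff k V g ->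
  ndiff k V (fun q => f q * g q).
Proof.
move=> Vo; elim: k f g => [//|k IH] f g /= hf hg.
have [df ddf] := hf; have [dg ddg] := hg; split.
  by move=> p Vp; apply: differentiableM; [exact: df|exact: dg].
move=> v; have hf' := @ndiff_pred k V f hf; have hg' := @ndiff_pred k V g hg.
apply: (eq_ndiff Vo _ (ndiffD Vo (IH _ _ hf' (ddg v)) (IH _ _ hg' (ddf v)))).
by move=> q Vq; apply/esym/deriveM; apply: diff_derivable; [exact: df|exact: dg].
Qed.

Lemma smoothD V f g : open V -> smooth V f -> smooth V g ->
  smooth V (fun q => f q + g q).
Proof. by move=> Vo sf sg k; exact: ndiffD. Qed.

Lemma smoothM V f g : open V -> smooth V f -> smooth V g ->
  smooth V (fun q => f q * g q).
Proof. by move=> Vo sf sg k; exact: ndiffM. Qed.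

Lemma smooth_cst V (c : R) : smooth V (fun=> c).
Proof. by move=> k; exact: ndiff_cst. Qed.

Lemma smoothN V f : open V -> smooth V f -> smooth V (fun q => - f q).
Proof.
move=> Vo sf; rewrite (_ : (fun q => _) = fun q => -1 * f q); last first.
  by apply/funext => q; rewrite mulN1r.
by apply: smoothM => //; exact: smooth_cst.
Qed.

Lemma smoothB V f g : open V -> smooth V f -> smooth V g ->
  smooth V (fun q => f q - g q).
Proof. by move=> Vo sf sg; apply: smoothD => //; exact: smoothN. Qed.

Lemma smooth_derive V f v : smooth V f -> smooth V ('D_v f).
Proof. by move=> sf k; have [_] := sf k.+1; apply. Qed.

Lemma smooth_differentiable V f p : smooth V f -> V p -> differentiable f p.
Proof. by move=> /(_ 1%N)[df _]; exact: df. Qed.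

Lemma sub_smooth V V' f : V' `<=` V -> smooth V f -> smooth V' f.
Proof. by move=> sV sf k; exact: sub_ndiff sV (sf k). Qed.

Lemma derive_fst_coord v p (j : 'I_N) :
  'D_v (fun q : cspace R N => q.1 0 j) p = v.1 0 j.
Proof. by apply: derive_additive => *; rewrite /= !mxE. Qed.

Lemma derive_snd_coord v p (j : 'I_N) :
  'D_v (fun q : cspace R N => q.2 0 j) p = v.2 0 j.
Proof. by apply: derive_additive => *; rewrite /= !mxE. Qed.

Lemma smooth_fst_coord V (j : 'I_N) : smooth V (fun q : cspace R N => q.1 0 j).
Proof.
case=> [//|k]; split; last first.
  move=> v; rewrite (_ : 'D_v _ = fun=> v.1 0 j); first exact: ndiff_cst.
  by apply/funext => q; exact: derive_fst_coord.
move=> p _; apply: (@differentiable_comp _ _ _ _ fst (fun x : 'rV[R]_N => x 0 j)).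
  exact: differentiable_fst.
exact: differentiable_coord.
Qed.

Lemma smooth_snd_coord V (j : 'I_N) : smooth V (fun q : cspace R N => q.2 0 j).
Proof.
case=> [//|k]; split; last first.
  move=> v; rewrite (_ : 'D_v _ = fun=> v.2 0 j); first exact: ndiff_cst.
  by apply/funext => q; exact: derive_snd_coord.
move=> p _; apply: (@differentiable_comp _ _ _ _ snd (fun x : 'rV[R]_N => x 0 j)).
  exact: differentiable_snd.
exact: differentiable_coord.
Qed.

Lemma smooth_derive_comm V f p v w : open V -> smooth V f -> V p ->
  'D_w ('D_v f) p = 'D_v ('D_w f) p.
Proof.
move=> Vo sf Vp; apply: derive_comm.
- near=> q; apply: (smooth_differentiable sf).
  by near: q; exact: open_nbhs_nbhs.
- exact: smooth_differentiable (smooth_derive v sf) Vp.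
- exact: smooth_differentiable (smooth_derive w sf) Vp.
Unshelve. all: by end_near. Qed.

End RealSmooth.

(** * Complex-valued functions and Wirtinger derivatives *)

(** [ring] compares its atoms up to conversion and may unfold the limits that
    define derivatives; replacing each derivative by a variable avoids this. *)
Ltac abstract_derivatives :=
  repeat match goal with |- context[Dc ?v ?f ?p] => generalize (Dc v f p); intro end.

Section ComplexCalculus.
Context {R : realType} {N : nat}.
Implicit Types (V : set (cspace R N)) (f g : cspace R N -> R[i])
  (p v : cspace R N) (X Y : cvec R N).

Lemma Re_add (x y : R[i]) : complex.Re (x + y) = complex.Re x + complex.Re y.
Proof. by case: x; case: y. Qed.

Lemma Im_add (x y : R[i]) : complex.Im (x + y) = complex.Im x + complex.Im y.
Proof. by case: x; case: y. Qed.

Lemma Re_mul (x y : R[i]) : complex.Re (x * y)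
  = complex.Re x * complex.Re y - complex.Im x * complex.Im y.
Proof. by case: x; case: y. Qed.

Lemma Im_mul (x y : R[i]) : complex.Im (x * y)
  = complex.Re x * complex.Im y + complex.Im x * complex.Re y.
Proof. by case: x; case: y. Qed.

Lemma Re_realM (r : R) (x : R[i]) : complex.Re (r%:C%C * x) = r * complex.Re x.
Proof. by rewrite Re_mul /= mul0r subr0. Qed.

Lemma Im_realM (r : R) (x : R[i]) : complex.Im (r%:C%C * x) = r * complex.Im x.
Proof. by rewrite Im_mul /= mul0r addr0. Qed.

Lemma Re_conj (x : R[i]) : complex.Re (conjc x) = complex.Re x.
Proof. by case: x. Qed.

Lemma Im_conj (x : R[i]) : complex.Im (conjc x) = - complex.Im x.
Proof. by case: x. Qed.

Lemma complex_eqP (x y : R[i]) : complex.Re x = complex.Re y ->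
  complex.Im x = complex.Im y -> x = y.
Proof. by case: x => a b; case: y => c d /= -> ->. Qed.

Definition cdifferentiable f p :=
  differentiable (fun q => complex.Re (f q)) p /\
  differentiable (fun q => complex.Im (f q)) p.

Lemma csmooth_cdifferentiable V f p : csmooth V f -> V p -> cdifferentiable f p.
Proof. by move=> [f1 f2] Vp; split; exact: smooth_differentiable Vp. Qed.

Lemma sub_csmooth V V' f : V' `<=` V -> csmooth V f -> csmooth V' f.
Proof. by move=> sV [f1 f2]; split; exact: sub_smooth sV _. Qed.

Lemma csmooth_cst V (c : R[i]) : csmooth V (fun=> c).
Proof. by split; exact: smooth_cst. Qed.

Lemma csmoothD V f g : open V -> csmooth V f -> csmooth V g ->
  csmooth V (fun q => f q + g q).
Proof.
move=> Vo [f1 f2] [g1 g2]; split.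
  by under eq_fun do rewrite Re_add; exact: smoothD.
by under eq_fun do rewrite Im_add; exact: smoothD.
Qed.

Lemma csmoothM V f g : open V -> csmooth V f -> csmooth V g ->
  csmooth V (fun q => f q * g q).
Proof.
move=> Vo [f1 f2] [g1 g2]; split.
  by under eq_fun do rewrite Re_mul; apply: smoothB => //; exact: smoothM.
by under eq_fun do rewrite Im_mul; apply: smoothD => //; exact: smoothM.
Qed.

Lemma csmooth_conj V f : open V -> csmooth V f -> csmooth V (fun q => conjc (f q)).
Proof.
move=> Vo [f1 f2]; split; first by under eq_fun do rewrite Re_conj.
by under eq_fun do rewrite Im_conj; exact: smoothN.
Qed.

Lemma csmoothN V f : open V -> csmooth V f -> csmooth V (fun q => - f q).
Proof.
move=> Vo sf; under eq_fun do rewrite -mulN1r.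
by apply: csmoothM => //; exact: csmooth_cst.
Qed.

Lemma csmooth_sum V (I : Type) (r : seq I) (F : I -> cspace R N -> R[i]) :
  open V -> (forall i, csmooth V (F i)) ->
  csmooth V (fun q => \sum_(i <- r) F i q).
Proof.
move=> Vo sF; elim: r => [|i r IH].
  by under eq_fun do rewrite big_nil; exact: csmooth_cst.
by under eq_fun do rewrite big_cons; exact: csmoothD.
Qed.

Lemma csmooth_cplx V (rho : cspace R N -> R) : smooth V rho -> csmooth V (cplx rho).
Proof. by move=> sr; split => //; exact: smooth_cst. Qed.

Lemma csmooth_Dc V f v : csmooth V f -> csmooth V (Dc v f).
Proof. by move=> [f1 f2]; split; exact: smooth_derive. Qed.

Lemma csmooth_dzbar V f j : open V -> csmooth V f -> csmooth V (dzbar j f).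
Proof.
move=> Vo sf; apply: csmoothM => //; first exact: csmooth_cst.
apply: csmoothD => //; first exact: csmooth_Dc.
by apply: csmoothM => //; [exact: csmooth_cst|exact: csmooth_Dc].
Qed.

Lemma csmooth_coordc V j : csmooth V (coordc j).
Proof. by split; [exact: smooth_fst_coord|exact: smooth_snd_coord]. Qed.

Lemma Dc_cst (c : R[i]) p v : Dc v (fun=> c) p = 0.
Proof. by rewrite /Dc !derive_cst. Qed.

Lemma DcD f g p v : cdifferentiable f p -> cdifferentiable g p ->
  Dc v (fun q => f q + g q) p = Dc v f p + Dc v g p.
Proof.
move=> [f1 f2] [g1 g2]; apply: complex_eqP; rewrite (Re_add, Im_add) /=.
  under eq_fun do rewrite Re_add.
  by rewrite -deriveD//; exact: diff_derivable.
under eq_fun do rewrite Im_add.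
by rewrite -deriveD//; exact: diff_derivable.
Qed.

Lemma DcM f g p v : cdifferentiable f p -> cdifferentiable g p ->
  Dc v (fun q => f q * g q) p = f p * Dc v g p + Dc v f p * g p.
Proof.
move=> [f1 f2] [g1 g2].
have [a1 a2] : derivable (fun q => complex.Re (f q)) p v /\
  derivable (fun q => complex.Im (f q)) p v by split; exact: diff_derivable.
have [b1 b2] : derivable (fun q => complex.Re (g q)) p v /\
  derivable (fun q => complex.Im (g q)) p v by split; exact: diff_derivable.
have expandB (a b c d a' b' c' d' : R) :
    (a * b' + b * a') - (c * d' + d * c') = a * b' - c * d' + (a' * b - c' * d).
  by ring.
have expandD (a b c d a' b' c' d' : R) :
    (a * d' + d * a') + (c * b' + b * c') = a * d' + c * b' + (a' * d + c' * b).
  by ring.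
apply: complex_eqP; rewrite ?(Re_add, Im_add, Re_mul, Im_mul) /=.
  under eq_fun do rewrite Re_mul.
  apply: (etrans (deriveB (derivableM a1 b1) (derivableM a2 b2))).
  by rewrite (deriveM a1 b1) (deriveM a2 b2); exact: expandB.
under eq_fun do rewrite Im_mul.
apply: (etrans (deriveD (derivableM a1 b2) (derivableM a2 b1))).
by rewrite (deriveM a1 b2) (deriveM a2 b1); exact: expandD.
Qed.

Lemma Dc_conj f p v : cdifferentiable f p ->
  Dc v (fun q => conjc (f q)) p = conjc (Dc v f p).
Proof.
move=> [f1 f2]; apply: complex_eqP; rewrite ?(Re_conj, Im_conj) /=.
  by under eq_fun do rewrite Re_conj.
under eq_fun do rewrite Im_conj.
by rewrite -deriveN//; exact: diff_derivable.
Qed.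

Lemma cdifferentiable_cst (c : R[i]) p : cdifferentiable (fun=> c) p.
Proof. by split; exact: differentiable_cst. Qed.

Lemma cdifferentiableD f g p : cdifferentiable f p -> cdifferentiable g p ->
  cdifferentiable (fun q => f q + g q) p.
Proof.
move=> [f1 f2] [g1 g2]; split.
  by under eq_fun do rewrite Re_add; exact: differentiableD.
by under eq_fun do rewrite Im_add; exact: differentiableD.
Qed.

Lemma cdifferentiableM f g p : cdifferentiable f p -> cdifferentiable g p ->
  cdifferentiable (fun q => f q * g q) p.
Proof.
move=> [f1 f2] [g1 g2]; split.
  by under eq_fun do rewrite Re_mul; apply: differentiableB; exact: differentiableM.
by under eq_fun do rewrite Im_mul; apply: differentiableD; exact: differentiableM.
Qed.

Lemma cdifferentiable_sum (I : Type) (r : seq I) (F : I -> cspace R N -> R[i]) p :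
  (forall i, cdifferentiable (F i) p) ->
  cdifferentiable (fun q => \sum_(i <- r) F i q) p.
Proof.
move=> dF; elim: r => [|i r IH].
  by under eq_fun do rewrite big_nil; exact: cdifferentiable_cst.
by under eq_fun do rewrite big_cons; exact: cdifferentiableD.
Qed.

Lemma act_dz X f p :
  act X f p = \sum_j (X.1 0 j * dz j f p + X.2 0 j * dzbar j f p).
Proof. by rewrite big_split. Qed.

Lemma act_cst X (c : R[i]) p : act X (fun=> c) p = 0.
Proof.
rewrite act_dz big1// => j _; rewrite /dz /dzbar !Dc_cst; ring.
Qed.

Lemma actD X f g p : cdifferentiable f p -> cdifferentiable g p ->
  act X (fun q => f q + g q) p = act X f p + act X g p.
Proof.
move=> df dg; rewrite !act_dz -big_split; apply: eq_bigr => j _ /=.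
by rewrite /dz /dzbar !DcD//; abstract_derivatives; ring.
Qed.

Lemma actM X f g p : cdifferentiable f p -> cdifferentiable g p ->
  act X (fun q => f q * g q) p = f p * act X g p + act X f p * g p.
Proof.
move=> df dg; rewrite !act_dz mulr_sumr mulr_suml -big_split.
by apply: eq_bigr => j _ /=; rewrite /dz /dzbar !DcM//; abstract_derivatives; ring.
Qed.

Lemma act_sum X (I : Type) (r : seq I) (F : I -> cspace R N -> R[i]) p :
  (forall i, cdifferentiable (F i) p) ->
  act X (fun q => \sum_(i <- r) F i q) p = \sum_(i <- r) act X (F i) p.
Proof.
move=> dF; elim: r => [|i r IH].
  by under eq_fun do rewrite big_nil; rewrite act_cst big_nil.
under eq_fun do rewrite big_cons.
by rewrite actD// ?big_cons ?IH//; exact: cdifferentiable_sum.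
Qed.

Lemma conjcD (x y : R[i]) : conjc (x + y) = conjc x + conjc y.
Proof. exact: rmorphD. Qed.

Lemma conjcN (x : R[i]) : conjc (- x) = - conjc x.
Proof. exact: rmorphN. Qed.

Lemma conjcM (x y : R[i]) : conjc (x * y) = conjc x * conjc y.
Proof. exact: rmorphM. Qed.

Lemma conjc_sum (I : Type) (r : seq I) (F : I -> R[i]) :
  conjc (\sum_(i <- r) F i) = \sum_(i <- r) conjc (F i).
Proof. exact: rmorph_sum. Qed.

Lemma conjc_i : conjc ('i%C : R[i]) = - 'i%C.
Proof. by apply: complex_eqP => /=; rewrite ?oppr0. Qed.

Lemma mulii : 'i%C * 'i%C = -1 :> R[i].
Proof. by rewrite -expr2 sqr_i. Qed.

Lemma conj_dz f p j : cdifferentiable f p ->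
  conjc (dz j f p) = dzbar j (fun q => conjc (f q)) p.
Proof.
move=> df; rewrite /dz /dzbar !Dc_conj//.
by rewrite conjcM conjcD conjcN conjcM conjc_inv conjc_nat conjc_i mulNr opprK.
Qed.

Lemma conj_dzbar f p j : cdifferentiable f p ->
  conjc (dzbar j f p) = dz j (fun q => conjc (f q)) p.
Proof.
move=> df; rewrite /dz /dzbar !Dc_conj//.
by rewrite conjcM conjcD conjcM conjc_inv conjc_nat conjc_i mulNr.
Qed.

Lemma act_conj X f p : cdifferentiable f p ->
  act (conjv X) (fun q => conjc (f q)) p = conjc (act X f p).
Proof.
move=> df; rewrite !act_dz conjc_sum; apply: eq_bigr => j _ /=.
by rewrite conjcD (conjcM (X.1 0 j)) (conjcM (X.2 0 j)) conj_dz// conj_dzbar// /conjv /= !mxE addrC.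
Qed.

Lemma conjvK : involutive (@conjv R N).
Proof.
by case=> a b; congr pair; apply/matrixP => i j; rewrite !mxE conjcK.
Qed.

Lemma act_linear (c : R[i]) X Y f p :
  act (c *: X + Y) f p = c * act X f p + act Y f p.
Proof.
rewrite !act_dz mulr_sumr -big_split; apply: eq_bigr => j _ /=.
by rewrite !mxE; ring.
Qed.

Lemma Dc_comm V f p v w : open V -> csmooth V f -> V p ->
  Dc v (Dc w f) p = Dc w (Dc v f) p.
Proof.
move=> Vo [f1 f2] Vp; apply: complex_eqP.
  exact: (smooth_derive_comm w v Vo f1 Vp).
exact: (smooth_derive_comm w v Vo f2 Vp).
Qed.

Lemma Dc_dzbar V f p j w : csmooth V f -> V p ->
  Dc w (dzbar j f) p = 2^-1 * (Dc w (Dc (delta_mx 0 j, 0) f) p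
                               + 'i%C * Dc w (Dc (0, delta_mx 0 j) f) p).
Proof.
move=> sf Vp; have dd v := csmooth_cdifferentiable (csmooth_Dc v sf) Vp.
have dc := cdifferentiable_cst.
have dM := cdifferentiableM (dc 'i%C p) (dd (0, delta_mx 0 j)).
apply: (etrans (DcM w (dc 2^-1 p) (cdifferentiableD (dd (delta_mx 0 j, 0)) dM))).
rewrite (DcD w (dd _) dM) (DcM w (dc _ _) (dd _)) !Dc_cst.
by abstract_derivatives; ring.
Qed.

Lemma dzbar_comm V f p j k : open V -> csmooth V f -> V p ->
  dzbar j (dzbar k f) p = dzbar k (dzbar j f) p.
Proof.
move=> Vo sf Vp; rewrite {1}/dzbar [RHS]/dzbar !(Dc_dzbar _ _ sf Vp).
move: (Dc_comm (delta_mx 0 j, 0) (delta_mx 0 k, 0) Vo sf Vp)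
  (Dc_comm (delta_mx 0 j, 0) (0, delta_mx 0 k) Vo sf Vp)
  (Dc_comm (0, delta_mx 0 j) (delta_mx 0 k, 0) Vo sf Vp)
  (Dc_comm (0, delta_mx 0 j) (0, delta_mx 0 k) Vo sf Vp).
by abstract_derivatives => -> -> -> ->; ring.
Qed.

Lemma cspace_decomp (a b : 'rV[R]_N) :
  ((a, b) : cspace R N) = \sum_j (a 0 j *: ((delta_mx 0 j, 0) : cspace R N)
                        + b 0 j *: ((0, delta_mx 0 j) : cspace R N)).
Proof.
rewrite [LHS]surjective_pairing [RHS]surjective_pairing.
rewrite (raddf_sum (fst : cspace R N -> _)) (raddf_sum (snd : cspace R N -> _)) /=.
congr pair.
  rewrite {1}(row_sum_delta a); apply: eq_bigr => j _.
  by rewrite scaler0 addr0.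
rewrite {1}(row_sum_delta b); apply: eq_bigr => j _.
by rewrite scaler0 add0r.
Qed.

Lemma derive_decomp (h : cspace R N -> R) p (a b : 'rV[R]_N) :
  differentiable h p ->
  'D_(a, b) h p = \sum_j (a 0 j * 'D_(delta_mx 0 j, 0) h p
                        + b 0 j * 'D_(0, delta_mx 0 j) h p).
Proof.
move=> dh; rewrite deriveE// cspace_decomp linear_sum.
by apply: eq_bigr => j _; rewrite linearD !linearZ /= !deriveE.
Qed.

Lemma Re_sum (I : Type) (r : seq I) (F : I -> R[i]) :
  complex.Re (\sum_(i <- r) F i) = \sum_(i <- r) complex.Re (F i).
Proof. by elim/big_rec2: _ => // i x y _ <-; rewrite Re_add. Qed.

Lemma Im_sum (I : Type) (r : seq I) (F : I -> R[i]) :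
  complex.Im (\sum_(i <- r) F i) = \sum_(i <- r) complex.Im (F i).
Proof. by elim/big_rec2: _ => // i x y _ <-; rewrite Im_add. Qed.

Lemma Dc_decomp f p (a b : 'rV[R]_N) : cdifferentiable f p ->
  Dc (a, b) f p = \sum_j ((a 0 j)%:C%C * Dc (delta_mx 0 j, 0) f p
                        + (b 0 j)%:C%C * Dc (0, delta_mx 0 j) f p).
Proof.
move=> [f1 f2]; apply: complex_eqP.
  rewrite Re_sum; apply: (etrans (derive_decomp a b f1)).
  apply: eq_bigr => j _; apply/esym/(etrans (Re_add _ _)).
  exact: (congr2 _ (Re_realM _ _) (Re_realM _ _)).
rewrite Im_sum; apply: (etrans (derive_decomp a b f2)).
apply: eq_bigr => j _; apply/esym/(etrans (Im_add _ _)).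
exact: (congr2 _ (Im_realM _ _) (Im_realM _ _)).
Qed.

(** [xpart X] and [ypart X] are the coefficients of a complex vector on the real
    coordinate fields [d/dx^j] and [d/dy^j], where [z^j = x^j + i y^j]. *)
Definition xpart X : 'rV[R[i]]_N := 2^-1 *: (X.1 + X.2).
Definition ypart X : 'rV[R[i]]_N := ('i%C / 2) *: (X.2 - X.1).
Definition real_part X : cspace R N :=
  (map_mx (@complex.Re R) (xpart X), map_mx (@complex.Re R) (ypart X)).
Definition imag_part X : cspace R N :=
  (map_mx (@complex.Im R) (xpart X), map_mx (@complex.Im R) (ypart X)).

Lemma complex_mxE (A : 'rV[R[i]]_N) j :
  ((map_mx (@complex.Re R) A) 0 j)%:C%C
  + 'i%C * ((map_mx (@complex.Im R) A) 0 j)%:C%C = A 0 j.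
Proof. by rewrite !mxE -complexE. Qed.

(** A complex vector is [v + i w] for two real vectors, which reduces statements
    about its action to real directional derivatives. *)
Lemma act_Dc X f p : cdifferentiable f p ->
  act X f p = Dc (real_part X) f p + 'i%C * Dc (imag_part X) f p.
Proof.
move=> df; rewrite !Dc_decomp// act_dz mulr_sumr -big_split.
apply: eq_bigr => j _ /=.
have E (u v a b c d : R[i]) : (a * u + b * v) + 'i%C * (c * u + d * v)
    = (a + 'i%C * c) * u + (b + 'i%C * d) * v by ring.
have wirtinger (s t c d : R[i]) : 2^-1 * (s + t) * c + 'i%C / 2 * (t - s) * d
    = s * (2^-1 * (c - 'i%C * d)) + t * (2^-1 * (c + 'i%C * d)) by ring.
apply/esym/(etrans (E _ _ _ _ _ _)).
rewrite [X in X * _ + _]complex_mxE.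
rewrite [X in _ + X * _]complex_mxE.
rewrite [xpart X 0 j]mxE [(X.1 + X.2) 0 j]mxE.
rewrite [ypart X 0 j]mxE [(X.2 - X.1) 0 j]mxE [(- X.1) 0 j]mxE /dz /dzbar.
exact: wirtinger.
Qed.

End ComplexCalculus.

(** * The contact form and its exterior derivative *)

Section LeviForm.
Context {R : realType} {N : nat}.
Implicit Types (V U : set (cspace R N)) (rho : cspace R N -> R)
  (f g : cspace R N -> R[i]) (p v : cspace R N) (X Y : cvec R N).

Lemma Dc_coordc v p (j : 'I_N) : Dc v (coordc j) p = coordc j v.
Proof.
by apply: complex_eqP; [exact: derive_fst_coord|exact: derive_snd_coord].
Qed.

Lemma coordc_parts (X : cvec R N) j :
  coordc j (real_part X) + 'i%C * coordc j (imag_part X) = X.1 0 j.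
Proof.
have E (a b c d : R) : (a +i* b)%C + 'i%C * (c +i* d)%C
    = (a%:C + 'i * c%:C + 'i * (b%:C + 'i * d%:C))%C.
  apply: complex_eqP; rewrite ?(Re_add, Im_add, Re_mul, Im_mul) /=; ring.
apply: (etrans (E _ _ _ _)).
apply: (etrans (congr2 (fun a b => a + 'i%C * b) (complex_mxE (xpart X) j)
  (complex_mxE (ypart X) j))).
rewrite [xpart X 0 j]mxE [(X.1 + X.2) 0 j]mxE.
rewrite [ypart X 0 j]mxE [(X.2 - X.1) 0 j]mxE [(- X.1) 0 j]mxE.
move: (X.1 0 j) (X.2 0 j) => s t.
have -> : 2^-1 * (s + t) + 'i%C * ('i%C / 2 * (t - s))
  = 2^-1 * (s + t + 'i%C * 'i%C * (t - s)) by ring.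
rewrite mulii (_ : s + t + -1 * (t - s) = 2 * s); last by ring.
by rewrite mulKf// pnatr_eq0.
Qed.

Lemma cdifferentiable_coordc p (j : 'I_N) : cdifferentiable (coordc j) p.
Proof. exact: (csmooth_cdifferentiable (@csmooth_coordc _ _ setT j)). Qed.

Lemma act_coordc X p j : act X (coordc j) p = X.1 0 j.
Proof.
rewrite act_Dc; last exact: cdifferentiable_coordc.
by rewrite !Dc_coordc coordc_parts.
Qed.

Lemma act_conj_coordc X p j : act X (fun q => conjc (coordc j q)) p = X.2 0 j.
Proof.
rewrite -[X]conjvK act_conj; last exact: cdifferentiable_coordc.
by rewrite act_coordc /conjv /= !mxE.
Qed.

Lemma pushforward_idfun p X : Defs.pushforward idfun p X = X.
Proof.
case: X => a b; congr pair; apply/rowP => j; rewrite mxE.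
  by rewrite act_coordc.
by rewrite act_conj_coordc.
Qed.

Lemma thetaE rho p X : theta rho p X = 'i%C * delbar (cplx rho) p X.
Proof. by rewrite /theta /pullback1 pushforward_idfun. Qed.

Lemma conj_dz_cplx U rho p j : smooth U rho -> U p ->
  conjc (dz j (cplx rho) p) = dzbar j (cplx rho) p.
Proof.
move=> sr Up; rewrite conj_dz; last first.
  exact: csmooth_cdifferentiable (csmooth_cplx sr) Up.
have -> // : (fun q => conjc (cplx rho q)) = cplx rho.
by apply/funext => q; rewrite /cplx conjc_real.
Qed.

Lemma conj_del U rho p X : smooth U rho -> U p ->
  conjc (del (cplx rho) p X) = delbar (cplx rho) p (conjv X).
Proof.
move=> sr Up; rewrite /del /delbar conjc_sum; apply: eq_bigr => j _.
by rewrite (conjcM (X.1 0 j)) (conj_dz_cplx j sr Up) /conjv /= mxE.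
Qed.

Lemma conj_delbar U rho p X : smooth U rho -> U p ->
  conjc (delbar (cplx rho) p X) = del (cplx rho) p (conjv X).
Proof.
by move=> sr Up; rewrite -{1}[X]conjvK -(conj_del _ sr Up) conjcK.
Qed.

Lemma smooth_field_conjf V (X : cspace R N -> cvec R N) : open V ->
  smooth_field V X -> smooth_field V (conjf X).
Proof.
move=> Vo sX j; have [s1 s2] := sX j; split.
  rewrite (_ : (fun q => _) = (fun q => conjc ((X q).2 0 j))); last first.
    by apply/funext => q; rewrite /conjf /conjv /= mxE.
  exact: csmooth_conj.
rewrite (_ : (fun q => _) = (fun q => conjc ((X q).1 0 j))); last first.
  by apply/funext => q; rewrite /conjf /conjv /= mxE.
exact: csmooth_conj.
Qed.

Lemma bracket2 (X Y : cspace R N -> cvec R N) p k : (bracket X Y p).2 0 k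
  = act (X p) (fun q => (Y q).2 0 k) p - act (Y p) (fun q => (X q).2 0 k) p.
Proof. exact: mxE. Qed.

Lemma act_theta U V rho X (Y : cspace R N -> cvec R N) p :
  open U -> smooth U rho -> U p -> smooth_field V Y -> V p ->
  act X (fun q => theta rho q (Y q)) p
  = 'i%C * (\sum_k ((Y p).2 0 k * act X (dzbar k (cplx rho)) p)
            + delbar (cplx rho) p (0, \row_k act X (fun q => (Y q).2 0 k) p)).
Proof.
move=> Uo sr Up sY Vp; under eq_fun do rewrite thetaE.
have dr k := csmooth_cdifferentiable (csmooth_dzbar k Uo (csmooth_cplx sr)) Up.
have dY k := csmooth_cdifferentiable (sY k).2 Vp.
have dt k := cdifferentiableM (dY k) (dr k).
have dc := @cdifferentiable_cst R N 'i%C p.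
rewrite (actM X dc (cdifferentiable_sum _ dt)) act_cst mul0r addr0.
rewrite (act_sum X _ dt) /delbar -big_split; congr (_ * _).
by apply: eq_bigr => k _; rewrite (actM X (dY k) (dr k)) /= mxE.
Qed.

(** The identity [d (i delbar rho) = i del delbar rho], for arbitrary smooth
    fields.  The derivatives of the components of [X] and [Y] cancel against the
    bracket; what is left are second derivatives of [rho], and the terms in
    [dzbar j (dzbar k rho)] cancel because they are symmetric in [j] and [k]. *)
Lemma extd_theta U V rho (X Y : cspace R N -> cvec R N) p :
  open U -> smooth U rho -> U p -> V p ->
  smooth_field V X -> smooth_field V Y ->
  extd (theta rho) X Y p = 'i%C * deldelbar rho p (X p) (Y p).
Proof.
move=> Uo sr Up Vp sX sY.
rewrite /extd (act_theta (X p) Uo sr Up sY Vp) (act_theta (Y p) Uo sr Up sX Vp).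
rewrite thetaE -!mulrBr; congr (_ * _).
set A := \sum_k _; set B := \sum_k _.
have -> : delbar (cplx rho) p (bracket X Y p) =
    delbar (cplx rho) p (0, \row_k act (X p) (fun q => (Y q).2 0 k) p)
  - delbar (cplx rho) p (0, \row_k act (Y p) (fun q => (X q).2 0 k) p).
  rewrite /delbar -sumrB; apply: eq_bigr => k _.
  rewrite bracket2 -mulrBl; congr (_ * _).
  by rewrite [X in _ = X - _]mxE [X in _ = _ - X]mxE.
have cancel (s t a b : R[i]) : s + a - (t + b) - (a - b) = s - t by ring.
apply: (etrans (cancel _ _ _ _)); rewrite {}/A {}/B /deldelbar.
pose BB j k := dzbar j (dzbar k (cplx rho)) p.
have expand (Z W : cvec R N) :
    \sum_k W.2 0 k * act Z (dzbar k (cplx rho)) p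
  = \sum_j \sum_k hess rho p j k * (Z.1 0 j * W.2 0 k)
    + \sum_j \sum_k BB j k * (Z.2 0 j * W.2 0 k).
  rewrite exchange_big [X in _ + X]exchange_big -big_split.
  apply: eq_bigr => k _; rewrite act_dz mulr_sumr -big_split /=.
  apply: eq_bigr => j _; rewrite -/(hess rho p j k) -/(BB j k).
  by move: (hess _ _ _ _) (BB _ _) => h b'; ring.
have symm : \sum_j \sum_k BB j k * ((Y p).2 0 j * (X p).2 0 k)
          = \sum_j \sum_k BB j k * ((X p).2 0 j * (Y p).2 0 k).
  rewrite exchange_big; apply: eq_bigr => j _; apply: eq_bigr => k _.
  rewrite /BB (dzbar_comm k j Uo (csmooth_cplx sr) Up).
  by rewrite [X in _ * X = _]mulrC.
rewrite !expand symm opprD addrACA subrr addr0 -sumrB.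
by apply: eq_bigr => j _; rewrite -sumrB; apply: eq_bigr => k _; rewrite mulrBr.
Qed.

Lemma Dc_cplx rho p v : Dc v (cplx rho) p = ('D_v rho p)%:C%C.
Proof. by apply: complex_eqP => //=; exact: derive_cst. Qed.

(** As [rho] is real, both the real and the imaginary part of a complex vector
    that kills [rho] are tangent to the level set. *)
Lemma act_level_set U rho f p X : open U -> smooth U rho -> U p -> rho p = 0 ->
  (exists w, 'D_w rho p <> 0) -> cdifferentiable f p ->
  (\forall q \near p, rho q = 0 -> f q = 0) ->
  act X (cplx rho) p = 0 -> act X f p = 0.
Proof.
move=> Uo sr Up rp0 [w dw] [f1 f2] f0.
have cr := csmooth_cdifferentiable (csmooth_cplx sr) Up.
have dr : \forall q \near p, differentiable rho q.
  near=> q; apply: (smooth_differentiable sr).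
  by near: q; exact: open_nbhs_nbhs.
have real v : 'D_v rho p = 0 -> Dc v f p = 0.
  move=> dv; apply: complex_eqP.
    apply: (derive_level_set dr f1 rp0 dv dw).
    by apply: filterS f0 => q H /H ->.
  apply: (derive_level_set dr f2 rp0 dv dw).
  by apply: filterS f0 => q H /H ->.
rewrite !act_Dc// !Dc_cplx => /eqP; rewrite eq_complex.
rewrite Re_add Im_add Re_mul Im_mul /= => /andP[/eqP e1 /eqP e2].
rewrite !real ?mulr0 ?addr0//.
  by move: e2; rewrite mul0r !(add0r, mul1r).
by move: e1; rewrite mul0r mulr0 subrr addr0.
Unshelve. all: by end_near. Qed.

End LeviForm.

(** * Smooth fields and connections *)

Lemma imaginary_neq0 (R : realType) : ('i%C : R[i]) != 0.
Proof. by rewrite eq_complex /= oner_eq0 andbF. Qed.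

Section Fields.
Context {R : realType} {N : nat}.
Implicit Types (V U M : set (cspace R N)) (f : cspace R N -> R[i])
  (p q : cspace R N) (X Y : cspace R N -> cvec R N).

Lemma smooth_field_cst V (c : cvec R N) : smooth_field V (fun=> c).
Proof. by move=> j; split; exact: csmooth_cst. Qed.

Lemma smooth_fieldD V X Y : open V -> smooth_field V X -> smooth_field V Y ->
  smooth_field V (fun q => X q + Y q).
Proof.
move=> Vo sX sY j; have [X1 X2] := sX j; have [Y1 Y2] := sY j; split.
  by under eq_fun do rewrite mxE; exact: csmoothD.
by under eq_fun do rewrite mxE; exact: csmoothD.
Qed.

Lemma smooth_fieldZ V f X : open V -> csmooth V f -> smooth_field V X ->
  smooth_field V (fun q => f q *: X q).
Proof.
move=> Vo sf sX j; have [X1 X2] := sX j; split.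
  by under eq_fun do rewrite mxE; exact: csmoothM.
by under eq_fun do rewrite mxE; exact: csmoothM.
Qed.

Lemma smooth_field_sum V (I : Type) (r : seq I) (F : I -> cspace R N -> cvec R N) :
  open V -> (forall i, smooth_field V (F i)) ->
  smooth_field V (fun q => \sum_(i <- r) F i q).
Proof.
move=> Vo sF; elim: r => [|i r IH].
  by under eq_fun do rewrite big_nil; exact: smooth_field_cst.
by under eq_fun do rewrite big_cons; exact: smooth_fieldD.
Qed.

Lemma sub_smooth_field V V' X : V' `<=` V -> smooth_field V X -> smooth_field V' X.
Proof. by move=> sV sX j; have [? ?] := sX j; split; exact: sub_csmooth sV _. Qed.

Lemma section_near_setT U V X p : open V -> V p -> smooth_field V X ->
  section_near U (fun=> setT) p X.
Proof. by move=> Vo Vp sX; exists V. Qed.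

(** The expansion of a connection on a combination of constant fields; it shows
    that the derivative of a field vanishes as soon as the components and their
    derivatives do. *)
Lemma connection_sum U nt p (v : cvec R N) V (J : Type) (r : seq J)
    (F : J -> cspace R N -> R[i]) (E : J -> cvec R N) :
  is_connection U (fun=> setT) nt -> U p -> open V -> V p ->
  (forall i, csmooth V (F i)) ->
  nt p v (fun q => \sum_(i <- r) F i q *: E i)
  = \sum_(i <- r) (act v (F i) p *: E i + F i p *: nt p v (fun=> E i)).
Proof.
move=> ct Up Vo Vp sF; have sec X := @section_near_setT U V X p Vo Vp.
have vT : [set: cvec R N] v by [].
have sE i : smooth_field V (fun q => F i q *: E i).
  by apply: smooth_fieldZ => //; exact: smooth_field_cst.
elim: r => [|i r IH].
  rewrite big_nil; under eq_fun do rewrite big_nil.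
  have s0 := sec _ (smooth_field_cst V 0).
  have := conn_add ct Up vT s0 s0; rewrite (_ : (fun q => 0 + 0) = fun=> 0).
    by move/eqP; rewrite -subr_eq subrr eq_sym => /eqP.
  by apply/funext => q; rewrite addr0.
rewrite big_cons -IH; under eq_fun do rewrite big_cons.
rewrite (conn_add ct Up vT (sec _ (sE i)) (sec _ (smooth_field_sum _ Vo sE))).
congr (_ + _); apply: (conn_leibniz ct Up vT); first by exists V.
exact: sec (smooth_field_cst V _).
Qed.

End Fields.

(** * Pseudohermitian geometry of the hypersurface *)

Section Hypersurface.
Context {R : realType} {N : nat}.
Context (U : set (cspace R N)) (rho : cspace R N -> R).
Context (U_open : open U) (rho_smooth : smooth U rho).
Context (rho_psh : strictly_psh U rho).
Context (drho_neq0 : forall p, hypersurface U rho p -> exists v, 'D_v rho p <> 0).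
Let M := hypersurface U rho.
Implicit Types (V : set (cspace R N)) (p q : cspace R N) (v : cvec R N)
  (X Y Z W : cspace R N -> cvec R N).

Lemma CTM_conjv q (Z : cvec R N) : U q -> CTM rho q Z -> CTM rho q (conjv Z).
Proof.
move=> Uq; rewrite /CTM /= => tZ.
rewrite (_ : cplx rho = fun q => conjc (cplx rho q)).
  rewrite act_conj ?tZ ?conjc0//.
  exact: csmooth_cdifferentiable (csmooth_cplx rho_smooth) Uq.
by apply/funext => x; rewrite /cplx conjc_real.
Qed.

Lemma extd_theta_section (E E' : cspace R N -> set (cvec R N)) X Y p : M p ->
  section_near M E p X -> section_near M E' p Y ->
  extd (theta rho) X Y p = 'i%C * deldelbar rho p (X p) (Y p).
Proof.
move=> [Up _] [V [Vo Vp] [sX _]] [V' [Vo' Vp'] [sY _]].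
apply: (@extd_theta R N U (V `&` V')) => //.
- by apply: sub_smooth_field sX => q [].
- by apply: sub_smooth_field sY => q [].
Qed.

Lemma theta_semi_isometric :
  semi_isometric M (CTM rho) (theta rho) idfun (omega rho).
Proof.
move=> p X Y Mp sX sY.
by rewrite (extd_theta_section Mp sX sY) /pullback2 !pushforward_idfun.
Qed.

Lemma inclusion_CR_immersion : CR_immersion M (CTM rho) U idfun.
Proof.
move=> p [Up _]; split => //.
- by exists setT; [exact: open_nbhsT|move=> j; exact: csmooth_coordc].
- by move=> X _; rewrite pushforward_idfun.
- by move=> X [_ X10]; rewrite pushforward_idfun.
Qed.

(** Complex-bilinear in [u] and [w], where [w] collects the (0,1)-components:
    the Hermitian Levi form of [rho] is [hess_form p u (map_mx conjc v)]. *)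
Definition hess_form p (u w : 'rV[R[i]]_N) : R[i] :=
  \sum_j \sum_k hess rho p j k * (u 0 j * w 0 k).

Lemma hess_formDl p (a : R[i]) u u' w :
  hess_form p (a *: u + u') w = a * hess_form p u w + hess_form p u' w.
Proof.
rewrite /hess_form mulr_sumr -big_split; apply: eq_bigr => j _ /=.
rewrite mulr_sumr -big_split; apply: eq_bigr => k _ /=.
by rewrite !mxE; move: (hess _ _ _ _) => h; ring.
Qed.

Lemma hess_formZr p (a : R[i]) u w : hess_form p u (a *: w) = a * hess_form p u w.
Proof.
rewrite /hess_form mulr_sumr; apply: eq_bigr => j _ /=.
rewrite mulr_sumr; apply: eq_bigr => k _ /=.
by rewrite !mxE; move: (hess _ _ _ _) => h; ring.
Qed.

Lemma deldelbar_T01 p (X : cvec R N) w : deldelbar rho p X (0, w) = hess_form p X.1 w.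
Proof.
apply: eq_bigr => j _; apply: eq_bigr => k _.
by rewrite mxE mul0r subr0.
Qed.

Lemma hess_form_gt0 p (u : 'rV[R[i]]_N) : U p -> u != 0 ->
  0 < hess_form p u (map_mx conjc u).
Proof.
move=> Up u0; rewrite (_ : hess_form _ _ _ =
  \sum_j \sum_k hess rho p j k * u 0 j * conjc (u 0 k)); first exact: rho_psh.
by apply: eq_bigr => j _; apply: eq_bigr => k _; rewrite mxE mulrA.
Qed.

(** For a real function, [dzbar j rho] is the conjugate of [dz j rho], so if all
    the [dz j rho] vanished then so would every real derivative of [rho]. *)
Lemma dz_cplx_neq0 p : M p -> exists j, dz j (cplx rho) p != 0.
Proof.
move=> Mp; have [Up _] := Mp; apply: contrapT => /forallNP z.
have z1 j : dz j (cplx rho) p = 0 by apply/eqP/negPn/negP; exact: z.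
have z2 j : dzbar j (cplx rho) p = 0.
  by rewrite -(conj_dz_cplx j rho_smooth Up) z1 conjc0.
have [[a b] dv] := drho_neq0 Mp; apply: dv.
have dr := csmooth_cdifferentiable (csmooth_cplx rho_smooth) Up.
have x0 j : Dc (delta_mx 0 j, 0) (cplx rho) p = 0.
  have E (s t : R[i]) : 2^-1 * (s - t) + 2^-1 * (s + t) = s by field.
  by apply: (etrans (esym (E _ ('i%C * Dc (0, delta_mx 0 j) (cplx rho) p))));
    apply: (etrans (congr2 _ (z1 j) (z2 j))); rewrite addr0.
have y0 j : Dc (0, delta_mx 0 j) (cplx rho) p = 0.
  have E (t : R[i]) : 2^-1 * (0 + 'i%C * t) = 0 -> t = 0.
    move=> /eqP; rewrite add0r !mulf_eq0 invr_eq0 pnatr_eq0 /=.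
    by rewrite (negbTE (imaginary_neq0 R)) => /eqP.
  by apply: E; rewrite -[RHS](z2 j) /dzbar x0.
suff : Dc (a, b) (cplx rho) p = 0 by rewrite Dc_cplx => -[].
rewrite Dc_decomp// big1// => j _.
by rewrite x0 y0 !mulr0 addr0.
Qed.

Lemma theta_pseudohermitian : pseudohermitian M (CTM rho) (theta rho).
Proof.
move=> p Mp; have [Up _] := Mp.
have theta_conj (X : cvec R N) : CTM rho p X ->
    theta rho p (conjv X) = conjc (theta rho p X).
  move=> tX; rewrite !thetaE conjcM conjc_i (conj_delbar _ rho_smooth Up).
  move: (CTM_conjv Up tX); rewrite /CTM /= /act => /eqP.
  by rewrite addrC addr_eq0 => /eqP ->; rewrite mulrN mulNr.
split => //.
- move=> X [tX X10].
  have tz : theta rho p X = 0.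
    rewrite thetaE /delbar big1 ?mulr0// => j _.
    by rewrite X10 mxE mul0r.
  by rewrite theta_conj// tz conjc0.
- have [j dj] := dz_cplx_neq0 Mp.
  have djb : dzbar j (cplx rho) p != 0.
    by rewrite -(conj_dz_cplx j rho_smooth Up) conjc_eq0.
  (* In the plane of d/dz^j and d/dzbar^j, the line tangent to M. *)
  pose X : cvec R N := (dzbar j (cplx rho) p *: delta_mx 0 j,
                        - dz j (cplx rho) p *: delta_mx 0 j).
  have dX : del (cplx rho) p X = dzbar j (cplx rho) p * dz j (cplx rho) p.
    rewrite /del (bigD1 j)//= !mxE !eqxx mulr1 big1 ?addr0// => k kj.
    by rewrite !mxE (negbTE kj) andbF mulr0 mul0r.
  have dbX : delbar (cplx rho) p X = - dz j (cplx rho) p * dzbar j (cplx rho) p.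
    rewrite /delbar (bigD1 j)//= !mxE !eqxx mulr1 big1 ?addr0// => k kj.
    by rewrite !mxE (negbTE kj) andbF mulr0 mul0r.
  exists X; first by rewrite /CTM /= /act dX dbX mulNr mulrC subrr.
  rewrite thetaE dbX; apply: (mulf_neq0 (imaginary_neq0 R) (mulf_neq0 _ djb)).
  by rewrite oppr_eq0.
- move=> Z sZ Zp0.
  have sZ' : section_near M (fun=> setT) p (conjf Z).
    have [V [Vo Vp] [sm _]] := sZ.
    by exists V => //; split => //; exact: smooth_field_conjf.
  have [V [Vo Vp] [_ /(_ p Vp Mp)[_ Z10]]] := sZ.
  rewrite (extd_theta_section Mp sZ sZ') mulrA mulNr mulii opprK mul1r.
  have -> : conjf Z p = (0, map_mx conjc (Z p).1).
    by rewrite /conjf /conjv Z10; congr pair; apply/rowP => j; rewrite !mxE conjc0.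
  rewrite deldelbar_T01; apply: hess_form_gt0 => //.
  apply: contra_neq Zp0 => Z1; rewrite [Z p]surjective_pairing Z1.
  by rewrite [X in (_, X)]Z10.
Qed.

(** The Reeb field is [i xi - i conj xi].  Put [tau] for its (1,0)-part.
    Reality, tangency and [theta T = 1] give [del rho (tau) = i], so that
    [eta = - i tau - xi] is a (1,0)-vector tangent to [M].  Both [tau], by the
    Reeb condition, and [xi], by transversality, are orthogonal for the Levi
    form to all such vectors; hence [eta] is orthogonal to itself, and strict
    plurisubharmonicity forces [eta = 0]. *)
Lemma reeb_transverse xi T p : transverse_field M rho xi ->
  reeb_field M (CTM rho) (theta rho) T -> M p -> (T p).1 = 'i%C *: xi p.
Proof.
move=> hxi hT Mp; have [Up _] := Mp.
have [xi1 [c xic]] := hxi p Mp; have [sT Treal T1 dT] := hT p Mp.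
set tau := (T p).1.
have T2 : (T p).2 = map_mx conjc tau by rewrite -{1}Treal.
have dbT : delbar (cplx rho) p (T p) = - 'i%C.
  move: T1; rewrite thetaE => /(congr1 (fun z => - 'i%C * z)).
  by rewrite mulrA mulNr mulii opprK mul1r mulr1.
have dT1 : del (cplx rho) p (vec10 tau) = 'i%C.
  have [V [Vo Vp] [_ /(_ p Vp Mp)]] := sT.
  by rewrite /CTM /= /act dbT => /eqP; rewrite subr_eq0 => /eqP.
pose eta : 'rV[R[i]]_N := (- 'i%C) *: tau + (- 1) *: xi p.
have dlin (a b : R[i]) (u w : 'rV[R[i]]_N) :
    del (cplx rho) p (vec10 (a *: u + b *: w))
    = a * del (cplx rho) p (vec10 u) + b * del (cplx rho) p (vec10 w).
  rewrite /del !mulr_sumr -big_split; apply: eq_bigr => j _ /=.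
  by rewrite !mxE; move: (dz _ _ _) => d; ring.
have deta : del (cplx rho) p (vec10 eta) = 0.
  by rewrite dlin dT1 xi1 mulNr mulii opprK mulr1 subrr.
have dbeta : delbar (cplx rho) p (0, map_mx conjc eta) = 0.
  have := conj_del (vec10 eta) rho_smooth Up; rewrite deta conjc0 => ->.
  by congr (delbar _ _ (_, _)); apply/rowP => j; rewrite !mxE conjc0.
(* The Reeb condition tests T against tangent fields, so the tangent vector
   conj eta at p has to be extended.  The combination Y of the constant fields
   conj eta and conj tau is killed by rho everywhere, and is a nonzero multiple
   of conj eta at p. *)
pose g q := delbar (cplx rho) q (0, map_mx conjc tau).
pose h q := delbar (cplx rho) q (0, map_mx conjc eta).
have gp : g p = - 'i%C by rewrite -dbT /g /delbar T2.
have smooth_db (w : 'rV[R[i]]_N) : csmooth U (fun q => delbar (cplx rho) q (0, w)).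
  apply: csmooth_sum => // j; apply: csmoothM => //; first exact: csmooth_cst.
  by apply: csmooth_dzbar => //; exact: csmooth_cplx.
pose Y q : cvec R N := g q *: (0, map_mx conjc eta) + - h q *: (0, map_mx conjc tau).
have sY : section_near M (CTM rho) p Y.
  exists U => //; split.
    apply: smooth_fieldD => //; apply: smooth_fieldZ => //; try exact: smooth_field_cst.
      exact: smooth_db.
    by apply: csmoothN => //; exact: smooth_db.
  move=> q _ _; rewrite /CTM /= /Y act_linear -[- h q *: _]addr0 act_linear.
  have act01 w : act (0, w) (cplx rho) q = delbar (cplx rho) q (0, w).
    by rewrite /act /del big1 ?add0r// => j _; rewrite mxE mul0r.
  rewrite !act01 -/(g q) -/(h q).
  have -> : delbar (cplx rho) q 0 = 0 by rewrite /delbar big1// => j _; rewrite mxE mul0r.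
  by rewrite addr0 mulrC mulNr addrC addNr.
have levi_tau : hess_form p tau (map_mx conjc eta) = 0.
  have := dT Y sY; rewrite (extd_theta_section Mp sT sY).
  have -> : Y p = (0, - 'i%C *: map_mx conjc eta).
    rewrite /Y /h dbeta oppr0 scale0r addr0 gp.
    by congr pair; rewrite scaler0.
  rewrite deldelbar_T01 hess_formZr mulrA mulrN mulii opprK mul1r.
  exact.
have levi_xi : hess_form p (xi p) (map_mx conjc eta) = 0.
  by rewrite -(deldelbar_T01 p (vec10 (xi p))) xic dbeta mulr0.
have levi_eta : hess_form p eta (map_mx conjc eta) = 0.
  rewrite {1}/eta hess_formDl levi_tau mulr0 add0r -[- 1 *: xi p]addr0 hess_formDl.
  rewrite levi_xi mulr0 add0r /hess_form big1// => j _; rewrite big1// => k _.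
  by rewrite mxE mul0r mulr0.
have eta0 : eta = 0.
  apply/eqP/negPn/negP => eta_neq0.
  by have := hess_form_gt0 Up eta_neq0; rewrite levi_eta ltxx.
move: eta0 => /(congr1 (fun u => 'i%C *: u)).
rewrite /eta scalerDr !scalerA scaler0 mulrN mulii opprK scale1r mulrN1 scaleNr.
by move=> /eqP; rewrite subr_eq0 => /eqP.
Qed.

(** The (0,1)-components of a section of [T10M] vanish along [M], but possibly
    not off [M]; their tangential derivatives vanish nevertheless. *)
Lemma T10_normal_derivative Z p v j : M p ->
  section_near M (T10M (CTM rho)) p Z -> CTM rho p v ->
  act v (fun q => (Z q).2 0 j) p = 0.
Proof.
move=> Mp [V [Vo Vp] [sZ TZ]] tv; have [Up rp0] := Mp.
apply: (act_level_set U_open rho_smooth Up rp0 (drho_neq0 Mp)) tv.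
  exact: csmooth_cdifferentiable (sZ j).2 Vp.
near=> q => rq0; have Vq : V q by near: q; exact: open_nbhs_nbhs.
have Uq : U q by near: q; exact: open_nbhs_nbhs.
by have [_ ->] := TZ q Vq (conj Uq rq0); rewrite mxE.
Unshelve. all: by end_near. Qed.

(** Off [M] the field [Z] need not be of type (1,0), so the identification of the
    (0,1)-part of the Chern connection with the Cauchy-Riemann operator applies
    only to its (1,0)-part.  The remaining part vanishes along [M], and its
    derivative in a tangent direction is zero by the Leibniz rule. *)
Lemma chern_derivative nt Z p v : chern_connection U (metric rho) nt -> M p ->
  section_near M (T10M (CTM rho)) p Z -> CTM rho p v -> T01 v ->
  nt p v Z = vec10 (\row_j act v (fun q => (Z q).1 0 j) p).
Proof.
move=> hnt Mp sZ tv v01; have ct := chern_conn hnt; have [Up _] := Mp.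
have [V [Vo Vp] [smZ TZ]] := sZ.
pose Z1 q : cvec R N := vec10 (Z q).1.
pose W q : cvec R N := \sum_j (Z q).2 0 j *: (0, delta_mx 0 j).
have smZ1 : smooth_field V Z1.
  move=> j; split; first exact: (smZ j).1.
  by under eq_fun do rewrite mxE; exact: csmooth_cst.
have smW : smooth_field V W.
  apply: smooth_field_sum => // j; apply: smooth_fieldZ => //; first exact: (smZ j).2.
  exact: smooth_field_cst.
have WE q : W q = (0, (Z q).2).
  rewrite [LHS]surjective_pairing /W.
  rewrite (raddf_sum (fst : cvec R N -> _)) (raddf_sum (snd : cvec R N -> _)) /=.
  congr pair; last by rewrite {2}(row_sum_delta (Z q).2).
  by rewrite big1// => j _; rewrite scaler0.
have -> : nt p v Z = nt p v (fun q => Z1 q + W q).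
  congr (nt p v _); apply/funext => q; rewrite WE [LHS]surjective_pairing /Z1.
  by congr pair; rewrite ?addr0 ?add0r.
have sec X := @section_near_setT R N U V X p Vo Vp.
rewrite (conn_add ct Up (Logic.I : [set: _] v) (sec _ smZ1) (sec _ smW)).
rewrite (connection_sum v _ _ ct Up Vo Vp (fun j => (smZ j).2)) big1 ?addr0.
  by apply: (chern_dbar hnt Up v01); exists V.
move=> j _; rewrite (T10_normal_derivative j Mp sZ tv) scale0r add0r.
by have [_ ->] := TZ p Vp Mp; rewrite mxE scale0r.
Qed.

(** The (1,0)-components of the torsion identity for [Z] and [conj W].  The term
    [nabla_Z (conj W)] has type (0,1), and the (1,0)-part of the bracket
    [[Z, conj W]] is minus the derivative of [Z] along [conj W], since the
    (1,0)-components of [conj W] vanish along [M]. *)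
Lemma tanaka_webster_derivative nb T Z W p :
  tanaka_webster M (CTM rho) (theta rho) T nb -> M p ->
  section_near M (T10M (CTM rho)) p Z -> section_near M (T10M (CTM rho)) p W ->
  (nb p (conjv (W p)) Z).1 = \row_j act (conjv (W p)) (fun q => (Z q).1 0 j) p
                             - extd (theta rho) Z (conjf W) p *: (T p).1.
Proof.
move=> hnb Mp sZ sW; have [Up _] := Mp; have cb := tw_conn hnb.
have tangent X : section_near M (T10M (CTM rho)) p X -> CTM rho p (X p).
  by move=> [V [_ Vp] [_ /(_ p Vp Mp)[]]].
have sW' : section_near M (CTM rho) p W.
  by have [V Vp [smW TW]] := sW; exists V => //; split => // q Vq Mq; case: (TW q Vq Mq).
have nbW : (nb p (Z p) (conjf W)).1 = 0.
  have tZ := CTM_conjv Up (tangent _ sZ).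
  have := conn_real cb Mp tZ sW'; rewrite conjvK => ->.
  have [_ T10W] := tw_T10 hnb Mp tZ sW.
  by rewrite /conjv /= T10W; apply/rowP => j; rewrite !mxE conjc0.
have := congr1 fst (tw_torsion11 hnb Mp sZ sW).
rewrite /torsion /= nbW => /rowP E; apply/rowP => j; move: (E j).
rewrite !mxE (_ : (fun q => (conjf W q).1 0 j) = (fun q => conjc ((W q).2 0 j))); last first.
  by apply/funext => q; rewrite /conjf /conjv /= mxE.
have -> : act (Z p) (fun q => conjc ((W q).2 0 j)) p = 0.
  rewrite -[Z p]conjvK act_conj.
    by rewrite (T10_normal_derivative j Mp sW) ?conjc0//; exact: CTM_conjv (tangent _ sZ).
  by have [V [_ Vp] [smW _]] := sW; exact: csmooth_cdifferentiable (smW j).2 Vp.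
rewrite /conjf; move: (nb _ _ _) (act _ _ _) (extd _ _ _ _ * _) => a b c.
by rewrite !sub0r opprK => <-; rewrite opprD opprK addrCA subrr addr0.
Qed.

(** The Chern and the Tanaka-Webster derivative both have as main term the
    componentwise derivative of [Z] along [conj W]; they differ by
    [d theta (Z, conj W)] times the (1,0)-part [i xi] of the Reeb field. *)
Lemma second_fundamental_form_T10 xi nt nb T Z W p :
  transverse_field M rho xi -> chern_connection U (metric rho) nt ->
  reeb_field M (CTM rho) (theta rho) T ->
  tanaka_webster M (CTM rho) (theta rho) T nb -> M p ->
  section_near M (T10M (CTM rho)) p Z -> section_near M (T10M (CTM rho)) p W ->
  second_fundamental_form nt nb (conjf W) Z p
  = ('i%C * extd (theta rho) Z (conjf W) p) *: vec10 (xi p).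
Proof.
move=> hxi hnt hT hnb Mp sZ sW; have [Up _] := Mp.
have [tW W10] : T10M (CTM rho) p (W p) by have [V [_ Vp] [_ /(_ p Vp Mp)]] := sW.
have tcW := CTM_conjv Up tW.
have cW01 : T01 (conjv (W p)).
  by rewrite /T01 /conjv /= W10; apply/rowP => j; rewrite !mxE conjc0.
have [_ nb2] := tw_T10 hnb Mp tcW sZ.
rewrite /second_fundamental_form [conjf W p]/(conjv (W p)).
rewrite (chern_derivative hnt Mp sZ tcW cW01).
rewrite [LHS]surjective_pairing /= (tanaka_webster_derivative hnb Mp sZ sW) nb2.
rewrite (reeb_transverse hxi hT Mp) opprB addrCA subrr addr0 scalerA mulrC.
by congr pair; rewrite subr0 scaler0.
Qed.

Lemma sqnorm_vec10 p u : sqnorm (metric rho) p (vec10 u)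
  = \sum_j \sum_k hess rho p j k * u 0 j * conjc (u 0 k).
Proof.
apply: eq_bigr => j _; apply: eq_bigr => k _.
by rewrite /conjv /vec10 /= !mxE conjc0 mul0r addr0 mulrA.
Qed.

End Hypersurface.

Lemma sqnormN (R : realType) (N : nat) (rho : cspace R N -> R) p (X : cvec R N) :
  sqnorm (metric rho) p (- X) = sqnorm (metric rho) p X.
Proof.
apply: eq_bigr => j _; apply: eq_bigr => k _.
by rewrite /conjv /= !mxE !conjcN !mulrNN.
Qed.

Theorem proposition2p17 (R : realType) (n : nat) (n_gt0 : (0 < n)%N)
    (U : set (cspace R n.+1)) (rho : cspace R n.+1 -> R)
    (U_open : open U) (rho_smooth : smooth U rho)
    (rho_psh : strictly_psh U rho)
    (drho_neq0 : forall p, hypersurface U rho p -> exists v, 'D_v rho p <> 0) :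
  let M := hypersurface U rho in
  [/\ pseudohermitian M (CTM rho) (theta rho),
      CR_immersion M (CTM rho) U idfun,
      semi_isometric M (CTM rho) (theta rho) idfun (omega rho) &
      forall xi : cspace R n.+1 -> 'rV[R[i]]_n.+1, transverse_field M rho xi ->
        (forall p, M p ->
           transverse_curvature rho xi p = sqnorm (metric rho) p (vec10 (xi p))) /\
        (forall nt nb T,
           chern_connection U (metric rho) nt ->
           reeb_field M (CTM rho) (theta rho) T ->
           tanaka_webster M (CTM rho) (theta rho) T nb ->
           (forall V (Z : 'I_n -> cspace R n.+1 -> cvec R n.+1),
              local_frame M (CTM rho) V Z ->
              forall p, V p -> M p -> forall a b : 'I_n,
                second_fundamental_form nt nb (conjf (Z a)) (Z b) p
                = - levi (theta rho) Z p b a *: vec10 (xi p)) /\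
           (forall V (Z : 'I_n -> cspace R n.+1 -> cvec R n.+1),
              orthonormal_frame M (CTM rho) (theta rho) V Z ->
              forall p, V p -> M p ->
                sqnorm (metric rho) p (vec10 (xi p))
                = sqnorm (metric rho) p (mean_curvature nt nb Z p)))].
Proof.
move=> M; split.
- exact: theta_pseudohermitian.
- exact: inclusion_CR_immersion.
- exact: theta_semi_isometric.
move=> xi hxi; split; first by move=> p Mp; rewrite sqnorm_vec10.
move=> nt nb T hnt hT hnb.
have II V (Z : 'I_n -> cspace R n.+1 -> cvec R n.+1) p a b :
    local_frame M (CTM rho) V Z -> V p -> M p ->
    second_fundamental_form nt nb (conjf (Z a)) (Z b) p
    = - levi (theta rho) Z p b a *: vec10 (xi p).
  move=> [Vo smZ frame] Vp Mp.
  have sec c : section_near M (T10M (CTM rho)) p (Z c).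
    by exists V => //; split => // q Vq Mq; have [] := frame q Vq Mq.
  rewrite (second_fundamental_form_T10 U_open rho_smooth rho_psh drho_neq0
    hxi hnt hT hnb Mp (sec b) (sec a)).
  by rewrite /levi mulNr opprK.
split=> V Z.
  by move=> frame p Vp Mp a b; exact: II frame Vp Mp.
move=> [frame orth] p Vp Mp.
suff -> : mean_curvature nt nb Z p = - vec10 (xi p) by rewrite sqnormN.
have II1 a : second_fundamental_form nt nb (conjf (Z a)) (Z a) p = - vec10 (xi p).
  by rewrite (II _ _ _ _ _ frame Vp Mp) orth// eqxx scaleN1r.
rewrite /mean_curvature (eq_bigr _ (fun a _ => II1 a)) sumr_const card_ord.
by rewrite -(scaler_nat n (- vec10 (xi p))) scalerA mulVf ?scale1r// pnatr_eq0 -lt0n.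
Qed.
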